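(* Let $P$ be a nonzero polynomial on $\mathbb{R}^n$, let $R>0$, let $K_P(R)=\{x\in\mathbb{R}^n:P(x)=0\text{ and }|x|\le R\}$, and let $$N_P=\sup\{d(P\cdot h): h\text{ is a harmonic polynomial}\}.$$ Then the space $$U_{N_P}:=\{Q\text{ polynomial}:\ \Delta^{N_P}Q=0\}$$ (more precisely, the set of restrictions of its elements to $K_P(R)$) is dense in the space $C(K_P(R),\mathbb{C})$ of all continuous complex-valued functions on $K_P(R)$ endowed with the supremum norm.
   Context: Polynomials are in $n$ real variables with complex coefficients. $\Delta=\sum_{i=1}^n\partial^2/\partial x_i^2$, $\Delta^N$ is its $N$-th iterate ($\Delta^0$ the identity), and $h$ is harmonic if $\Delta h=0$. The polyharmonic degree of a polynomial $f$ is $d(f):=\min\{N\in\mathbb{N}_0:\Delta^{N+1}f=0\}$. (The supremum $N_P$ is finite.) *)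

(* Defs.v *)
(* MathComp world. The notations of multinomials clash with those of
   MathComp-Analysis, hence the filtered import of mpoly. *)
From HB Require Import structures.
From mathcomp Require Import all_boot all_order all_algebra.
From mathcomp Require Import complex.
From mathcomp Require Import all_classical all_reals all_analysis.
From mathcomp Require Import -(notations) mpoly.

Set Implicit Arguments.
Unset Strict Implicit.
Unset Printing Implicit Defensive.

Import Order.TTheory GRing.Theory Num.Theory.
Import numFieldNormedType.Exports.

Local Open Scope classical_set_scope.
Local Open Scope ring_scope.

Section Polyharmonic.
Variables (C : comNzRingType) (n : nat).
Local Notation cpoly := (mpoly n C).
Implicit Types p q h : cpoly.

Definition laplacian p : cpoly := \sum_(i < n) mderiv i (mderiv i p).

Definition iter_laplacian (N : nat) p : cpoly := iter N laplacian p.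

Definition harmonic p : Prop := laplacian p = 0.

Lemma msize_mderiv (i : 'I_n) p k :
  (mmeasure mdeg p <= k.+1)%N ->
  (mmeasure mdeg (mderiv i p) <= k)%N.
Proof.
move=> pk; rewrite mmeasureE; apply/bigmax_leqP_seq => m mp _.
have : (mnm_add m (mnm1 i)) \in msupp p.
  move: mp; rewrite !mcoeff_msupp mcoeff_mderiv.
  by apply: contraNN => /eqP ->; rewrite mul0rn.
move=> /msize_mdeg_lt; rewrite mdegD mdeg1 addn1 => lt.
by rewrite -ltnS; apply: leq_trans pk.
Qed.

Lemma laplacianD : {morph laplacian : p q / p + q}.
Proof.
move=> p q; rewrite /laplacian -big_split /=; apply: eq_bigr => i _.
by rewrite !mderivD.
Qed.

Lemma laplacian0 : laplacian 0 = 0.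
Proof. by rewrite /laplacian big1 // => i _; rewrite !mderiv0. Qed.

Lemma iter_laplacianD N : {morph iter_laplacian N : p q / p + q}.
Proof.
by rewrite /iter_laplacian => p q; elim: N => //= N ->; rewrite laplacianD.
Qed.

Lemma iter_laplacian0 N : iter_laplacian N 0 = 0.
Proof. by rewrite /iter_laplacian; elim: N => //= N ->; rewrite laplacian0. Qed.

Lemma harmonic_mderiv (i : 'I_n) h : harmonic h -> harmonic (mderiv i h).
Proof.
rewrite /harmonic /laplacian => hh.
transitivity (mderiv i (\sum_(j < n) mderiv j (mderiv j h))).
  rewrite raddf_sum; apply: eq_bigr => j _.
  by rewrite (mderiv_comm i j) (mderiv_comm i j).
by rewrite hh mderiv0.
Qed.

Lemma iter_laplacian_mul N p h :
  (mmeasure mdeg p <= N)%N -> harmonic h ->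
  iter_laplacian N (p * h) = 0.
Proof.
elim: N p h => [|N IH] p h.
  rewrite leqn0 mmeasure_poly_eq0 => /eqP -> _.
  by rewrite mul0r.
move=> pN hh; rewrite /iter_laplacian iterSr -/(iter_laplacian _ _).
have -> : laplacian (p * h) = \sum_(i < n)
    (mderiv i (mderiv i p) * h +
      (mderiv i p * mderiv i h + mderiv i p * mderiv i h)).
  have -> : \sum_(i < n) (mderiv i (mderiv i p) * h +
      (mderiv i p * mderiv i h + mderiv i p * mderiv i h)) =
    \sum_(i < n) (mderiv i (mderiv i p) * h +
      (mderiv i p * mderiv i h + mderiv i p * mderiv i h)) + p * laplacian h.
    by rewrite hh mulr0 addr0.
  rewrite /laplacian mulr_sumr -big_split /=; apply: eq_bigr => i _.
  by rewrite mderivM mderivD !mderivM !addrA.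
rewrite (big_morph (iter_laplacian N) (@iter_laplacianD N) (@iter_laplacian0 N)).
rewrite big1 // => i _.
have pi := msize_mderiv i pN.
rewrite !iter_laplacianD !(IH _ (mderiv i h)) ?addr0 //; last 1 first.
- exact: harmonic_mderiv.
apply: IH => //; apply: msize_mderiv; exact: leq_trans pi _.
Qed.

Lemma iter_laplacian_nilp p : exists N, iter_laplacian N.+1 p == 0.
Proof.
exists (mmeasure mdeg p); apply/eqP.
have harmonic1 : harmonic 1.
  rewrite /harmonic /laplacian big1 // => i _.
  by rewrite -[1]/(mpolyC n 1) mderivC mderiv0.
by have := iter_laplacian_mul (leqnSn (mmeasure mdeg p)) harmonic1; rewrite mulr1.
Qed.

Definition polyharm_degree p : nat := ex_minn (iter_laplacian_nilp p).

Definition polyharm_degrees p : set nat :=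
  [set polyharm_degree (p * h) | h in harmonic].

(* The supremum is one of a nonempty bounded set of naturals, by the lemma below,
   so that the default value [0] plays no role. *)
Definition max_polyharm_degree p : nat := supremum 0%N (polyharm_degrees p).

Lemma max_polyharm_degreeP p :
  supremums (polyharm_degrees p) (max_polyharm_degree p).
Proof.
have [|N supN] := @nat_supremums_neq0 (polyharm_degrees p).
  exists (mmeasure mdeg p) => _ [h hh <-]; rewrite /polyharm_degree.
  case: ex_minnP => d _; apply; apply/eqP.
  by rewrite /iter_laplacian /= -/(iter_laplacian _ _) iter_laplacian_mul
    ?laplacian0.
rewrite /max_polyharm_degree /supremum; case: ifPn => [/eqP A0|_].
  have : polyharm_degrees p (polyharm_degree (p * 0)) by exists 0; [exact: laplacian0|].
  by rewrite A0.
by case: xgetP => [m _ //|/(_ N) /(_ supN)].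
Qed.

End Polyharmonic.

Section Density.
Variables (R : realType) (n : nat).
Local Notation cpoly := (mpoly n R[i]).

(* Value at a point of R^n, as a map to [R[i]^o], which is where the library puts
   the topology of the complex plane. *)
Definition peval (p : cpoly) (x : 'rV[R]_n) : R[i]^o :=
  meval (fun i => (x ord0 i)%:C%C) p.

(* Euclidean; the library norm on ['rV[R]_n] is the max norm. *)
Definition enorm (x : 'rV[R]_n) : R := Num.sqrt (\sum_(i < n) x ord0 i ^+ 2).

Definition zero_locus_ball (p : cpoly) (r : R) : set 'rV[R]_n :=
  [set x | peval p x = 0 /\ enorm x <= r].

Definition polyharmonic (N : nat) : set cpoly := [set q | iter_laplacian N q = 0].

(* Extended-real, hence never a default value; it is [-oo] on the empty set, which
   is harmless in the strict upper bound below. *)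
Definition sup_norm (K : set 'rV[R]_n) (g : 'rV[R]_n -> R[i]^o) : \bar R :=
  ereal_sup [set (Normc.normc (g x))%:E | x in K].

(* C(K, C) is given by the maps on R^n whose restriction to K is continuous;
   [sup_norm K] only depends on that restriction. *)
Definition dense_in_CK (K : set 'rV[R]_n) (V : set cpoly) : Prop :=
  forall f : 'rV[R]_n -> R[i]^o, {within K, continuous f} ->
  forall e : R, 0 < e ->
  exists2 q, V q & (sup_norm K (fun x => f x - peval q x)%R < e%:E)%E.

End Density.

(* Main.v *)
Require Import Defs.
From HB Require Import structures.
From mathcomp Require Import all_boot all_order all_algebra.
From mathcomp Require Import complex.
From mathcomp Require Import all_classical all_reals all_analysis.
From mathcomp Require Import -(notations) mpoly.
From mathcomp Require Import ring lra zify.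
Import Order.TTheory GRing.Theory Num.Theory.
Import numFieldNormedType.Exports.
Local Open Scope ring_scope.

(** Why the theorem holds. Let [N] be the largest polyharmonic degree of a product
    of [P] with a harmonic polynomial. The point is purely algebraic: every
    polynomial [f] can be written [f = P * q + u] where the [N]-th iterated Laplacian
    of [u] is zero ([polyharmonic_division]). On the zero set of [P] the polynomials
    [f] and [u] coincide, so the restrictions of [N]-polyharmonic polynomials are the
    restrictions of all polynomials, and these are dense by the Stone-Weierstrass
    theorem ([stone_weierstrass], [polynomials_dense]).

    The division is first done for two special polynomials. For the quadratic form
    [rho = x . x] it is Fischer's decomposition: every polynomial is a multiple of
    [rho] plus a harmonic one ([quad_division]). For an isotropic linear form [w] it
    is a Cauchy problem on a characteristic hyperplane, with the same conclusion
    ([coord_division]). Multiplication by either of them maps the kernel of an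
    iterated Laplacian into the next kernel, so the divisions can be composed and
    one can divide by [rho ^ J * w ^ mu] modulo the kernel of the [(J + mu)]-th
    iterated Laplacian.

    A general [P] is reduced to this case by a leading-form argument. In coordinates
    [(z, w, y)] with [rho = 2 z w + |y| ^ 2], give [z], [y], [w] weights close to
    0, 1, 2. The Laplacian is then homogeneous, and a division by the
    leading form of [P] yields a division by [P] ([lead_division]). Expand
    [P = sum_j rho ^ j * r_j] with [r_j] of degree at most one in the first variable,
    and let [J] maximize [j + deg r_j]. The top form of [r_J] is nonzero at some
    isotropic vector ([isotropic_nonvanishing]); taking this vector as the [w]-axis
    ([isotropic_frame]) makes [rho ^ J * w ^ mu], where [mu = deg r_J], the leading
    form of [P]. Finally [J + mu] is at most [N]: the polynomial [z ^ mu] is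
    harmonic, and [J + mu] Laplacians map [P * z ^ mu] to a nonzero constant
    ([lead_test]). In one variable the leading monomial of [P] has the required
    form [rho ^ J * x ^ mu] with [mu <= 1], and [x] plays the role of [z] and [w]. *)

Set Implicit Arguments.
Unset Strict Implicit.
Unset Printing Implicit Defensive.

Local Notation "''x_' i" := (mpolyX _ (mnm1 i)) (at level 8, i at level 2).

(** * Laplacians attached to an involution of the variables *)

Section Derivations.
Variables (C : comNzRingType) (n : nat).
Local Notation poly_n := (mpoly n C).
Implicit Types p q : poly_n.

Lemma mpoly_ring_ind (S : poly_n -> Prop) :
  (forall c, S (mpolyC n c)) -> (forall i, S 'x_i) ->
  (forall p q, S p -> S q -> S (p + q)) ->
  (forall p q, S p -> S q -> S (p * q)) -> forall p, S p.
Proof.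
move=> SC SX SD SM; elim/mpolyind => [|c m p _ _ Sp].
  by rewrite -(mpolyC0 n C); exact: SC.
apply: (SD) => //; rewrite -mul_mpolyC; apply: (SM) => //.
rewrite mpolyXE_id; elim/big_rec: _ => [|i q _ Sq].
  by rewrite -(mpolyC1 n C); exact: SC.
apply: (SM) => //; elim: (m i) => [|k Sk].
  by rewrite expr0 -(mpolyC1 n C); exact: SC.
by rewrite exprS; exact: (SM).
Qed.

Lemma mderivXU (i j : 'I_n) : mderiv i ('x_j : poly_n) = (i == j)%:R.
Proof.
rewrite mderivX mnm1E eq_sym; have [->|ne] := eqVneq j i; rewrite ?scale0r //.
rewrite scale1r; suff -> : mnm_sub (mnm1 i) (mnm1 i) = mnm0.
  by rewrite mpolyX0.
by apply/mnmP => k; rewrite mnmBE subnn mnm0E.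
Qed.

Definition euler p : poly_n := \sum_i 'x_i * mderiv i p.

Lemma euler_is_linear : linear euler.
Proof.
move=> c p q; rewrite /euler scaler_sumr -big_split; apply: eq_bigr => i _ /=.
by rewrite linearP mulrDr scalerAr.
Qed.
HB.instance Definition _ := GRing.isLinear.Build C _ _ _ euler euler_is_linear.

Lemma mderiv_euler i p : mderiv i (euler p) = euler (mderiv i p) + mderiv i p.
Proof.
rewrite /euler raddf_sum /=.
under eq_bigr do rewrite mderivM mderivXU mderiv_comm.
rewrite big_split /= addrC; congr (_ + _).
rewrite (bigD1 i) //= eqxx mul1r big1 ?addr0 // => j ne.
by rewrite eq_sym (negbTE ne) mul0r.
Qed.

Lemma eulerX m : euler (mpolyX C m) = (mdeg m)%:R *: mpolyX C m.
Proof.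
rewrite mdegE natr_sum scaler_suml /euler; apply: eq_bigr => i _.
rewrite mderivX -scalerAr -mpolyXD.
have [->|mi0] := eqVneq (m i) 0%N; first by rewrite !scale0r.
congr (_ *: mpolyX _ _); apply/mnmP => j.
rewrite mnmDE mnmBE mnm1E; case: eqP => [<-|]; rewrite ?subn0 //.
by rewrite subnKC // lt0n.
Qed.

(** [s = id] gives the Euclidean Laplacian. When [s] exchanges two variables
    [z] and [w] and fixes the others, [lap s] is the same operator written in
    isotropic coordinates, with symbol [2 z w + |y| ^ 2]. *)
Section Laplacian.
Variable s : 'I_n -> 'I_n.

Definition lap p : poly_n := \sum_i mderiv (s i) (mderiv i p).
Definition quad : poly_n := \sum_i 'x_i * 'x_(s i).
Definition grad p q : poly_n := \sum_i mderiv i p * mderiv (s i) q.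

Lemma lap_is_linear : linear lap.
Proof.
move=> c p q; rewrite /lap scaler_sumr -big_split; apply: eq_bigr => i _ /=.
by rewrite !linearP.
Qed.
HB.instance Definition _ := GRing.isLinear.Build C _ _ _ lap lap_is_linear.

Lemma iter_lap_is_linear k : linear (iter k lap).
Proof. by elim: k => [//|k IH] c p q; rewrite !iterS IH linearP. Qed.
HB.instance Definition _ k :=
  GRing.isLinear.Build C _ _ _ (iter k lap) (iter_lap_is_linear k).

Lemma lapD : {morph lap : p q / p + q}. Proof. exact: raddfD. Qed.
Lemma lapMn k : {morph lap : p / p *+ k}. Proof. exact: raddfMn. Qed.

Lemma iter_lapD k : {morph iter k lap : p q / p + q}.
Proof. exact: raddfD. Qed.
Lemma iter_lap0 k : iter k lap 0 = 0. Proof. exact: raddf0. Qed.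

Lemma lapC c : lap (mpolyC n c) = 0.
Proof. by rewrite /lap big1 // => i _; rewrite mderivC mderiv0. Qed.

Lemma lapX i : lap 'x_i = 0.
Proof.
rewrite /lap big1 // => j _; rewrite mderivXU.
by rewrite -mpolyC_nat mderivC.
Qed.

Lemma lap_mderiv i p : lap (mderiv i p) = mderiv i (lap p).
Proof.
rewrite /lap raddf_sum; apply: eq_bigr => j _ /=.
by rewrite (mderiv_comm i j) (mderiv_comm i).
Qed.

Hypothesis sK : involutive s.

Lemma lapM p q : lap (p * q) = lap p * q + p * lap q + (grad p q) *+ 2.
Proof.
have E : grad p q = \sum_i mderiv (s i) p * mderiv i q.
  rewrite /grad (reindex_inj (inv_inj sK)) /=.
  by apply: eq_bigr => i _; rewrite sK.
rewrite mulr2n {2}E /lap /grad mulr_sumr mulr_suml -!big_split /=.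
apply: eq_bigr => i _; rewrite !mderivM mderivD !mderivM; ring.
Qed.

Lemma gradX i q : grad 'x_i q = mderiv (s i) q.
Proof.
rewrite /grad (bigD1 i) //= mderivXU eqxx mul1r big1 ?addr0 // => j ne.
by rewrite mderivXU (negbTE ne) mul0r.
Qed.

Lemma lapXM i q : lap ('x_i * q) = 'x_i * lap q + (mderiv (s i) q) *+ 2.
Proof. by rewrite lapM lapX mul0r add0r gradX. Qed.

Lemma mderiv_quad i : mderiv i quad = 'x_(s i) *+ 2.
Proof.
rewrite /quad raddf_sum /=.
under eq_bigr do rewrite mderivM !mderivXU.
rewrite big_split /= mulr2n; congr (_ + _).
  by rewrite (bigD1 i) //= eqxx mul1r big1 ?addr0 // => j ne;
    rewrite ?(negbTE ne) 1?eq_sym ?(negbTE ne) mul0r.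
rewrite (bigD1 (s i)) //= sK eqxx mulr1 big1 ?addr0 // => j ne.
rewrite (_ : (i == s j) = false) ?mulr0 //.
by apply/eqP => e; rewrite e sK eqxx in ne.
Qed.

Lemma lap_quadM q :
  lap (quad * q) = quad * lap q + (euler q) *+ 4 + q *+ (2 * n).
Proof.
rewrite lapM; have -> : lap quad = 2%:R * n%:R.
  rewrite /lap; under eq_bigr do rewrite mderiv_quad mderivMn mderivXU eqxx.
  by rewrite sumr_const card_ord /= -[LHS]mulr_natr.
have -> : grad quad q = euler q *+ 2.
  rewrite /grad /euler (reindex_inj (inv_inj sK)) /= -sumrMnl.
  by apply: eq_bigr => i _; rewrite mderiv_quad !sK mulrnAl.
ring.
Qed.

Lemma lap_euler q : lap (euler q) = euler (lap q) + lap q *+ 2.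
Proof.
rewrite {1}/lap; under eq_bigr do rewrite mderiv_euler mderivD mderiv_euler.
rewrite 2!big_split /= -/(lap q) mulr2n addrA; congr (_ + _ + _).
by rewrite /lap raddf_sum.
Qed.

(** The [sl_2] relation: [quad], the Laplacian and the shifted Euler operator
    span a copy of [sl_2]. *)
Lemma iter_lap_quadM k q :
  iter k.+1 lap (quad * q) = quad * iter k.+1 lap q +
    euler (iter k lap q) *+ (4 * k.+1) +
    iter k lap q *+ (2 * k.+1 * (n + 2 * k)).
Proof.
elim: k => [|k IH]; first by rewrite /= lap_quadM !muln1 muln0 addn0.
rewrite [LHS]iterS IH !iterS.
rewrite !lapD !lapMn lap_quadM lap_euler; ring.
Qed.

End Laplacian.
End Derivations.
(** * Weights of monomials *)

Section Weights.
Variables (C : comNzRingType) (n : nat) (w : 'I_n -> nat).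
Local Notation poly_n := (mpoly n C).
Implicit Types p q : poly_n.

Definition wt (m : multinom n) := (\sum_i m i * w i)%N.

Lemma wtD m1 m2 : wt (mnm_add m1 m2) = (wt m1 + wt m2)%N.
Proof.
by rewrite /wt -big_split; apply: eq_bigr => i _; rewrite mnmDE mulnDl.
Qed.

Lemma wt1 i : wt (mnm1 i) = w i.
Proof.
rewrite /wt (bigD1 i) //= mnm1E eqxx mul1n big1 ?addn0 // => j ne.
by rewrite mnm1E eq_sym (negbTE ne).
Qed.

(** The bound is strict so that the bound [0] means [p = 0]; truncated
    subtraction of bounds is then the right operation on quotients. *)
Definition wlt d p := all (fun m => wt m < d)%N (msupp p).

Lemma wltP d p :
  reflect (forall m, mcoeff m p != 0 -> (wt m < d)%N) (wlt d p).
Proof.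
apply: (iffP allP) => h m; last by rewrite mcoeff_msupp; exact: h.
by rewrite -mcoeff_msupp; exact: h.
Qed.

Lemma wlt_coeff d p m : wlt d p -> (d <= wt m)%N -> mcoeff m p = 0.
Proof.
move=> /wltP h le; apply: contraTeq le => /h; by rewrite -ltnNge.
Qed.

Lemma wlt_mono d e p : (d <= e)%N -> wlt d p -> wlt e p.
Proof. by move=> de /wltP h; apply/wltP => m /h lt; exact: leq_trans de. Qed.

Lemma wlt00 d : wlt d 0.
Proof. by apply/wltP => m; rewrite mcoeff0 eqxx. Qed.

Lemma wlt0 p : wlt 0 p -> p = 0.
Proof. by move=> h; apply/mpolyP => m; rewrite mcoeff0 (wlt_coeff h). Qed.

Lemma wltD d p q : wlt d p -> wlt d q -> wlt d (p + q).
Proof.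
move=> hp hq; apply/wltP => m; rewrite mcoeffD ltnNge.
by apply: contraNN => le; rewrite !(wlt_coeff _ le) ?addr0.
Qed.

Lemma wltZ d c p : wlt d p -> wlt d (c *: p).
Proof.
move=> hp; apply/wltP => m; rewrite mcoeffZ ltnNge.
by apply: contraNN => le; rewrite !(wlt_coeff _ le) ?mulr0.
Qed.

Lemma wltN d p : wlt d p -> wlt d (- p).
Proof. by rewrite -scaleN1r; exact: wltZ. Qed.

Lemma wlt_sum I (r : seq I) (Q : pred I) d (F : I -> poly_n) :
  (forall i, Q i -> wlt d (F i)) -> wlt d (\sum_(i <- r | Q i) F i).
Proof.
move=> h; apply: (big_ind (fun p => wlt d p)) => //; first exact: wlt00.
exact: wltD.
Qed.

(** The successor on one side accounts for the two bounds being strict. *)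
Lemma wltM a d p q : wlt a.+1 p -> wlt d q -> wlt (a + d) (p * q).
Proof.
move=> hp hq; apply/allP => m /msuppM_le /allpairsP[[m1 m2] /= [s1 s2 ->]].
rewrite wtD; move/allP: hp => /(_ _ s1) /=; move/allP: hq => /(_ _ s2) /=; lia.
Qed.

Lemma wltC c : wlt 1 (mpolyC n c).
Proof.
apply/wltP => m; rewrite mcoeffC; case: (m =P mnm0) => [-> _|_]; last first.
  by rewrite mulr0n mulr0 eqxx.
by rewrite /wt big1 // => i _; rewrite mnm0E.
Qed.

Lemma wltE a k p : wlt a.+1 p -> wlt (k * a).+1 (p ^+ k).
Proof.
move=> hp; elim: k => [|k IH].
  by rewrite expr0 -(mpolyC1 n C) mul0n; exact: wltC.
by rewrite exprS mulSn -addnS; exact: wltM.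
Qed.

Lemma wltX m : wlt (wt m).+1 (mpolyX C m).
Proof.
apply/wltP => m'; rewrite mcoeffX; by case: (m =P m') => [->|_] //; rewrite mulr0n eqxx.
Qed.

Lemma wltXU i : wlt (w i).+1 ('x_i : poly_n).
Proof. by rewrite -wt1; exact: wltX. Qed.

Lemma wlt_mderiv i d p : wlt d p -> wlt (d - w i) (mderiv i p).
Proof.
move=> h; apply/wltP => m; rewrite mcoeff_mderiv ltnNge; apply: contraNN => le.
by rewrite (wlt_coeff h) ?mul0rn // wtD wt1 addnC -leq_subLR.
Qed.

Variables (s : 'I_n -> 'I_n) (kap : nat).
Hypothesis ws : forall i, (w i + w (s i) = kap)%N.

Lemma wlt_lap d p : wlt d p -> wlt (d - kap) (lap s p).
Proof.
move=> h; apply: wlt_sum => i _; rewrite -(ws i) subnDA.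
by do 2! apply: wlt_mderiv.
Qed.

Lemma wlt_iter_lap k d p : wlt d p -> wlt (d - k * kap) (iter k (lap s) p).
Proof.
move=> h; elim: k => [|k IH]; first by rewrite subn0.
by rewrite mulSn addnC subnDA; exact: wlt_lap.
Qed.

Lemma wlt_quad : wlt kap.+1 (quad C s).
Proof.
apply: wlt_sum => i _; rewrite -(ws i) -addnS; apply: wltM; exact: wltXU.
Qed.

End Weights.

(** * Division modulo the kernel of an iterated Laplacian *)

Section Division.
Variables (C : numFieldType) (n : nat) (w : 'I_n -> nat).
Variables (s : 'I_n -> 'I_n) (kap : nat).
Hypothesis ws : forall i, (w i + w (s i) = kap)%N.
Hypothesis sK : involutive s.
Local Notation poly_n := (mpoly n C).
Local Notation lap := (@lap C n s).
Local Notation quad := (@quad C n s).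
Implicit Types p q f g l : poly_n.

(** Solve [D k q = g] first; the error [l * lap q] is a multiple of [l], and
    pulling [l] out of the equation only replaces [D k] by [D k.+1] while the
    weight of the right-hand side has dropped. Hence induction on the weight,
    for all [k] at once. *)
Lemma perturbed_onto l (D J : nat -> poly_n -> poly_n) a b :
  (forall k, {morph D k : p q / p + q}) -> (forall k g, D k (J k g) = g) ->
  (forall k q, l * lap (l * q) + D k (l * q) = l * (l * lap q + D k.+1 q)) ->
  (forall k d g, wlt w d g -> wlt w (d + b) (J k g)) ->
  wlt w a.+1 l -> (a + b)%N = kap -> (0 < a)%N ->
  forall d k g, wlt w d g ->
  exists2 q, wlt w (d + b) q & l * lap q + D k q = g.
Proof.
move=> Dadd DJ shift wJ wl abk a0.
elim/ltn_ind => d IH k g wg.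
pose q0 := J k g; pose g' := - lap q0.
have wq0 : wlt w (d + b) q0 by exact: wJ.
have wg' : wlt w (d + b - kap) g' by apply: wltN; exact: wlt_lap.
have [le|lt] := leqP (d + b) kap.
  exists q0 => //; rewrite DJ.
  have /eqP : g' = 0 by apply: (@wlt0 _ _ w); rewrite (eqP (_ : _ - _ == 0)%N) in wg'.
  by rewrite oppr_eq0 => /eqP ->; rewrite mulr0 add0r.
have [|q' wq' eq'] := IH _ _ k.+1 g' wg'; first by lia.
exists (q0 + l * q').
  apply: wltD => //; apply: (wlt_mono _ (wltM wl wq')); lia.
rewrite raddfD /= Dadd mulrDr addrACA shift eq' DJ /g' mulrN; ring.
Qed.

(** The weight bound on the quotient is what lets the division by a leading form
    be iterated in [lead_division]. *)
Definition lap_division N a p := forall d f, wlt w d f ->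
  exists2 q, wlt w (d - a) q & iter N lap (f - p * q) = 0.

(** [f - l * q] is harmonic as soon as [q] solves [lap (l * q) = lap f], an
    equation of the kind treated above. *)
Lemma perturbed_division l (D J : nat -> poly_n -> poly_n) a b :
  (forall k, {morph D k : p q / p + q}) -> (forall k g, D k (J k g) = g) ->
  (forall k q, l * lap (l * q) + D k (l * q) = l * (l * lap q + D k.+1 q)) ->
  (forall q, lap (l * q) = l * lap q + D 0%N q) ->
  (forall k d g, wlt w d g -> wlt w (d + b) (J k g)) ->
  wlt w a.+1 l -> (a + b)%N = kap -> (0 < a)%N ->
  lap_division 1 a l.
Proof.
move=> Dadd DJ shift lapl wJ wl abk a0 d f wf.
have [le|lt] := leqP d kap.
  exists 0; first exact: wlt00.
  rewrite mulr0 subr0 /=; apply: (@wlt0 _ _ w).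
  by have := wlt_lap ws wf; rewrite (eqP (_ : _ - _ == 0)%N).
have [q wq eq] := perturbed_onto Dadd DJ shift wJ wl abk a0 0 (wlt_lap ws wf).
exists q; first by apply: (wlt_mono _ wq); lia.
by rewrite /= raddfB /= lapl eq subrr.
Qed.

Lemma wlt_monomials d b (c : multinom n -> C) (t : multinom n -> multinom n) g :
  (forall m, wt w (t m) <= wt w m + b)%N -> wlt w d g ->
  wlt w (d + b) (\sum_(m <- msupp g) (mcoeff m g * c m) *: mpolyX C (t m)).
Proof.
move=> ht /allP wg; rewrite big_seq; apply: wlt_sum => m mg.
apply: wltZ; apply: (wlt_mono _ (wltX C w (t m))).
by have := ht m; have := wg m mg; rewrite /=; lia.
Qed.

Lemma eulerM p q : euler (p * q) = euler p * q + p * euler q.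
Proof.
rewrite /euler mulr_suml mulr_sumr -big_split; apply: eq_bigr => i _ /=.
rewrite mderivM; ring.
Qed.

Lemma euler_quad : euler quad = quad *+ 2.
Proof.
rewrite /euler -sumrMnl; apply: eq_bigr => i _.
by rewrite mderiv_quad // mulrnAr.
Qed.

(** The Fischer decomposition for [quad]. Here [D k] is diagonal on monomials,
    with eigenvalues that are positive since [n > 0]. *)
Lemma quad_division : (0 < n)%N -> (0 < kap)%N -> lap_division 1 kap quad.
Proof.
move=> n_gt0 kap_gt0.
pose D k q : poly_n := euler q *+ (4 * k.+1) + q *+ (2 * k.+1 * (n + 2 * k)).
pose e k (m : multinom n) : C :=
  (4 * k.+1 * mdeg m + 2 * k.+1 * (n + 2 * k))%:R.
apply: (@perturbed_division quad D
  (fun k g => \sum_(m <- msupp g) (mcoeff m g * (e k m)^-1) *: mpolyX C m)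
  kap 0%N) => //.
- by move=> k p q; rewrite /D linearD; ring.
- move=> k g; rewrite /D [in RHS](mpolyE g) raddf_sum -!sumrMnl -big_split /=.
  apply: eq_bigr => m _; rewrite linearZ /= eulerX scalerA.
  rewrite -[X in X + _]scaler_nat -[X in _ + X]scaler_nat !scalerA.
  rewrite -scalerDl; congr (_ *: _).
  have e0 : e k m != 0 by rewrite pnatr_eq0; lia.
  rewrite -[RHS](mulfVK e0); set x := (e k m)^-1; rewrite /e; ring.
- move=> k q; rewrite /D lap_quadM // eulerM euler_quad; ring.
- move=> q; rewrite lap_quadM // /D; ring.
- move=> k d g; apply: wlt_monomials => m; by rewrite addn0.
- exact: wlt_quad.
- by rewrite addn0.
Qed.

(** A Cauchy-Kovalevskaya statement: data on the characteristic hyperplane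
    [x_i = 0] extend to a harmonic polynomial, because [lap ('x_i * q)] equals
    [2 * mderiv (s i) q] up to a multiple of ['x_i] and differentiation in another
    variable can be inverted. *)
Lemma coord_division i : s i != i -> (0 < w i)%N -> lap_division 1 (w i) 'x_i.
Proof.
move=> si wi; pose D k q : poly_n := mderiv (s i) q *+ (2 * k.+1).
apply: (@perturbed_division 'x_i D
  (fun k g => \sum_(m <- msupp g)
     (mcoeff m g * ((2 * k.+1 * (m (s i)).+1)%:R)^-1) *:
        mpolyX C (mnm_add m (mnm1 (s i)))) (w i) (w (s i))) => //.
- by move=> k p q; rewrite /D linearD; ring.
- move=> k g; rewrite /D [in RHS](mpolyE g) raddf_sum -sumrMnl /=.
  apply: eq_bigr => m _; rewrite linearZ /= mderivX addmK.
  rewrite -[LHS]scaler_nat !scalerA; congr (_ *: _).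
  by rewrite mnmDE mnm1E eqxx addn1 mulrAC -natrM mulrC mulfVK ?pnatr_eq0.
- move=> k q; rewrite /D lapXM // mderivM mderivXU (negbTE si) mulr0n; ring.
- move=> q; rewrite lapXM // /D; ring.
- move=> k d g; apply: wlt_monomials => m; by rewrite wtD wt1.
- exact: wltXU.
Qed.

Definition raises_order l :=
  forall M v, iter M lap v = 0 -> iter M.+1 lap (l * v) = 0.

Lemma quad_raises : raises_order quad.
Proof.
move=> M v v0; rewrite iter_lap_quadM // iterS v0 !raddf0 /=.
by rewrite mulr0 !mul0rn !addr0.
Qed.

Lemma iter_lapXM M i v : iter M.+1 lap ('x_i * v) =
  'x_i * iter M.+1 lap v + mderiv (s i) (iter M lap v) *+ (2 * M.+1).
Proof.
elim: M => [|M IH]; first by rewrite /= lapXM // muln1.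
rewrite [LHS]iterS IH !iterS lapD lapMn lapXM // lap_mderiv; ring.
Qed.

Lemma coord_raises i : raises_order 'x_i.
Proof.
move=> M v v0; rewrite iter_lapXM iterS v0 raddf0 mulr0 raddf0.
by rewrite mul0rn addr0.
Qed.

(** Divide by [l], then divide the quotient by [p]: the second remainder gets
    multiplied by [l], which costs one more Laplacian. *)
Lemma lap_divisionM l p M a b : raises_order l ->
  lap_division 1 a l -> lap_division M b p ->
  lap_division M.+1 (a + b) (l * p).
Proof.
move=> rl dl dp d f wf; have [q wq fq] := dl d f wf.
have [q' wq' qq'] := dp _ q wq; exists q'; first by rewrite subnDA.
have -> : f - l * p * q' = (f - l * q) + l * (q - p * q') by ring.
by rewrite iter_lapD (rl _ _ qq') addr0 iterSr [lap _]fq iter_lap0.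
Qed.

Lemma lap_division1 : lap_division 0 0 1.
Proof.
by move=> d f wf; exists f; rewrite ?subn0 //= mul1r subrr.
Qed.

Lemma lap_divisionXM l p k M a b : raises_order l ->
  lap_division 1 a l -> lap_division M b p ->
  lap_division (k + M) (k * a + b) (l ^+ k * p).
Proof.
move=> rl dl dp; elim: k => [|k IH].
  by rewrite expr0 mul1r.
by rewrite exprS -mulrA mulSn -addnA; exact: lap_divisionM.
Qed.

(** Dividing by the leading form [c *: p0] instead of [p] makes an error
    of smaller weight, which is divided in turn. *)
Lemma lead_division N a (c : C) p0 p : c != 0 -> wlt w a (p - c *: p0) ->
  lap_division N a p0 -> lap_division N a p.
Proof.
move=> c0 wp dp0; elim/ltn_ind => d IH f wf.
have [q wq fq] := dp0 d f wf.
pose g := - (p - c *: p0) * (c^-1 *: q).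
have E : f - p * (c^-1 *: q) = (f - p0 * q) + g.
  have X : (c *: p0) * (c^-1 *: q) = p0 * q.
    by rewrite -scalerAl -scalerAr scalerA mulfV // scale1r.
  by rewrite /g mulNr mulrBl X; ring.
have wg : wlt w d.-1 g.
  rewrite /g; case: a wp wq {dp0 IH fq} => [/wlt0 -> _|a wp].
    by rewrite oppr0 mul0r wlt00.
  have [le|lt] := leqP d a.+1.
    rewrite (eqP (_ : d - a.+1 == 0)%N) // => /wlt0 ->.
    by rewrite scaler0 mulr0 wlt00.
  move=> wq; have := wltM (wltN wp) (wltZ c^-1 wq).
  by apply: wlt_mono; lia.
have [d0|d0] := posnP d.
  exists 0; first exact: wlt00.
  by move: wf; rewrite d0 => /wlt0 ->; rewrite mulr0 subr0 raddf0.
have [|q' wq' gq'] := IH d.-1 _ g wg; first by lia.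
exists (c^-1 *: q + q').
  by apply: wltD; [exact: wltZ|apply: (wlt_mono _ wq'); lia].
by rewrite mulrDr opprD addrA E -addrA iter_lapD fq add0r.
Qed.

Lemma iter_lap_quadX J k v (c : C) : (0 < n)%N -> c != 0 -> iter k lap v = mpolyC n c ->
  exists2 c', c' != 0 & iter (J + k) lap (quad ^+ J * v) = mpolyC n c'.
Proof.
move=> n_gt0 c0 vc; elim: J => [|J [c' c'0 IH]].
  by exists c => //; rewrite expr0 mul1r.
exists (c' *+ (2 * (J + k).+1 * (n + 2 * (J + k)))).
  by rewrite -mulr_natr mulf_neq0 // pnatr_eq0; lia.
rewrite exprS -mulrA addSn iter_lap_quadM // iterS IH lapC mulr0 add0r.
rewrite (_ : euler _ = 0) ?mul0rn ?add0r; last first.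
  by rewrite /euler big1 // => i _; rewrite mderivC mulr0.
by rewrite mpolyCMn.
Qed.

Lemma iter_lap_coordX k i h : lap h = 0 ->
  iter k lap ('x_i ^+ k * h) =
    iter k (mderiv (s i)) h *+ (2 ^ k * k`!) /\
  iter k.+1 lap ('x_i ^+ k * h) = 0.
Proof.
move=> h0; elim: k => [|k [IH1 IH2]].
  by rewrite expr0 mul1r.
rewrite exprS -mulrA; split; last exact: coord_raises.
rewrite iter_lapXM IH2 mulr0 add0r IH1 raddfMn /= -mulrnA.
congr (_ *+ _); rewrite expnS factS; lia.
Qed.

Lemma iter_mderivX k i :
  iter k (mderiv i) ('x_i ^+ k : poly_n) = mpolyC n (k`!)%:R.
Proof.
have D j : mderiv i ('x_i ^+ j.+1 : poly_n) = 'x_i ^+ j *+ j.+1.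
  elim: j => [|j IH]; first by rewrite expr1 expr0 mderivXU eqxx.
  by rewrite exprS mderivM mderivXU eqxx IH mul1r mulrnAr -exprS -mulrS.
elim: k => [|k IH]; first by rewrite /= mpolyC1.
rewrite iterSr D.
have FM j p : iter k (mderiv i) (p *+ j) = iter k (mderiv i) p *+ j.
  by elim: k {IH} => [//|k IH]; rewrite !iterS IH raddfMn.
by rewrite FM IH -mpolyCMn factS mulnC natrM mulr_natr.
Qed.

(** A lower bound for the polyharmonic degree of [p * 'x_(s i) ^+ k]. The leading
    form times ['x_(s i) ^+ k] has weight [(J + k) * kap], so that [J + k] Laplacians
    turn it into a constant, nonzero by the [sl_2] relation, and kill all
    terms of smaller weight. *)
Lemma lead_test (c : C) p i J k : (0 < n)%N -> c != 0 ->
  wlt w (J * kap + k * w i) (p - c *: (quad ^+ J * 'x_i ^+ k)) ->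
  lap ('x_(s i) ^+ k) = 0 ->
  exists2 c', c' != 0 &
    iter (J + k) lap (p * 'x_(s i) ^+ k) = mpolyC n c'.
Proof.
move=> n_gt0 c0 wp h0.
have [E _] := iter_lap_coordX k i h0.
rewrite iter_mderivX -mpolyCMn in E.
have [|c1 c10 E1] := iter_lap_quadX J n_gt0 _ E.
  by rewrite -mulrnA pnatr_eq0 -lt0n !muln_gt0 expn_gt0 !fact_gt0.
exists (c * c1); first exact: mulf_neq0.
pose g := p - c *: (quad ^+ J * 'x_i ^+ k).
have -> : p * 'x_(s i) ^+ k =
  c *: (quad ^+ J * ('x_i ^+ k * 'x_(s i) ^+ k)) + g * 'x_(s i) ^+ k.
  by rewrite /g mulrBl -scalerAl mulrA addrC subrK.
rewrite iter_lapD linearZ /= E1 mpolyCM mul_mpolyC [X in _ + X](@wlt0 _ _ w) ?addr0 //.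
have wx := wltE k (wltXU C w (s i)).
have := wltM wx wp; rewrite mulrC -/g => /(wlt_iter_lap ws (J + k)).
by rewrite -(ws i); apply: wlt_mono; lia.
Qed.

End Division.

(** * Linear substitutions and restriction to lines *)

Section Substitution.
Variable C : numFieldType.

Lemma mmapXU n (R : comNzRingType) (f : {rmorphism C -> R}) (h : 'I_n -> R) i :
  mmap f h ('x_i : mpoly n C) = h i.
Proof. by rewrite mmapX mmap1U. Qed.

Definition linform k (a : 'I_k -> C) : mpoly k C := \sum_j a j *: 'x_j.

Lemma mderiv_linform k (a : 'I_k -> C) j :
  mderiv j (linform a) = mpolyC k (a j).
Proof.
rewrite /linform raddf_sum (bigD1 j) //= linearZ /= mderivXU eqxx.
rewrite big1 ?addr0 => [|i ne]; first by rewrite -mul_mpolyC mulr1.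
by rewrite linearZ /= mderivXU eq_sym (negbTE ne) scaler0.
Qed.

Definition linsub n k (M : 'I_n -> 'I_k -> C) (p : mpoly n C) : mpoly k C :=
  mmap (@mpolyC k C) (fun i => linform (M i)) p.
HB.instance Definition _ n k (M : 'I_n -> 'I_k -> C) :=
  GRing.RMorphism.copy (linsub M)
    (mmap (@mpolyC k C) (fun i => linform (M i))).

Lemma linsubC n k (M : 'I_n -> 'I_k -> C) c :
  linsub M (mpolyC n c) = mpolyC k c.
Proof. exact: mmapC. Qed.

Lemma linsubX n k (M : 'I_n -> 'I_k -> C) i : linsub M 'x_i = linform (M i).
Proof. exact: mmapXU. Qed.

Lemma linsub_id n (M : 'I_n -> 'I_n -> C) (p : mpoly n C) :
  (forall i j, M i j = (i == j)%:R) -> linsub M p = p.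
Proof.
move=> Mid; elim/mpoly_ring_ind: p => [c|i|p q Ep Eq|p q Ep Eq].
- exact: linsubC.
- rewrite linsubX /linform (bigD1 i) //= Mid eqxx scale1r big1 ?addr0 // => j ne.
  by rewrite Mid eq_sym (negbTE ne) scale0r.
- by rewrite rmorphD /= Ep Eq.
- by rewrite rmorphM /= Ep Eq.
Qed.

Lemma linsub_linform n k (M : 'I_n -> 'I_k -> C) a :
  linsub M (linform a) = linform (fun j => \sum_i a i * M i j).
Proof.
rewrite /linform raddf_sum /=.
under eq_bigr do rewrite -mul_mpolyC rmorphM /= linsubC linsubX mul_mpolyC
  scaler_sumr.
rewrite exchange_big /=; apply: eq_bigr => j _; rewrite scaler_suml.
by apply: eq_bigr => i _; rewrite scalerA.
Qed.

Lemma linsub_comp n k l (M : 'I_n -> 'I_k -> C) (N : 'I_k -> 'I_l -> C) p :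
  linsub N (linsub M p) = linsub (fun i j => \sum_a M i a * N a j) p.
Proof.
elim/mpoly_ring_ind: p => [c|i|p q Ep Eq|p q Ep Eq].
- by rewrite !linsubC.
- by rewrite !linsubX linsub_linform.
- by rewrite !rmorphD /= Ep Eq.
- by rewrite !rmorphM /= Ep Eq.
Qed.

Lemma mderiv_linsub n k (M : 'I_n -> 'I_k -> C) a p :
  mderiv a (linsub M p) = \sum_i M i a *: linsub M (mderiv i p).
Proof.
elim/mpoly_ring_ind: p => [c|i|p q Ep Eq|p q Ep Eq].
- rewrite linsubC mderivC big1 // => i _; by rewrite mderivC raddf0 scaler0.
- rewrite linsubX mderiv_linform (bigD1 i) //= mderivXU eqxx rmorph1.
  rewrite -mul_mpolyC mulr1 big1 ?addr0 // => j ne.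
  by rewrite mderivXU (negbTE ne) rmorph0 scaler0.
- rewrite rmorphD /= mderivD Ep Eq -big_split; apply: eq_bigr => i _ /=.
  by rewrite mderivD rmorphD scalerDr.
- rewrite rmorphM /= mderivM Ep Eq mulr_suml mulr_sumr -big_split.
  apply: eq_bigr => i _ /=.
  by rewrite mderivM rmorphD !rmorphM /= scalerDr scalerAl scalerAr.
Qed.

(** A substitution intertwines two Laplacians when it carries one symbol to
    the other. *)
Lemma lap_linsub n k (M : 'I_n -> 'I_k -> C) (s : 'I_k -> 'I_k)
    (t : 'I_n -> 'I_n) p :
  (forall i j, \sum_a M i a * M j (s a) = (j == t i)%:R) ->
  lap s (linsub M p) = linsub M (lap t p).
Proof.
move=> MM; rewrite /lap.
under eq_bigr => a _.
  rewrite mderiv_linsub raddf_sum /=.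
  under eq_bigr => i _ do rewrite linearZ /= mderiv_linsub scaler_sumr.
  over.
rewrite exchange_big raddf_sum /=; apply: eq_bigr => i _.
rewrite exchange_big /=.
under eq_bigr => j _.
  under eq_bigr => a _ do rewrite scalerA.
  rewrite -scaler_suml MM; over.
rewrite (bigD1 (t i)) //= eqxx scale1r big1 ?addr0 // => j ne.
by rewrite (negbTE ne) scale0r.
Qed.

Lemma linsub_quad n k (M : 'I_n -> 'I_k -> C) (s : 'I_k -> 'I_k)
    (t : 'I_n -> 'I_n) :
  (forall a b, \sum_i M i a * M (t i) b = (b == s a)%:R) ->
  linsub M (quad C t) = quad C s.
Proof.
move=> MM; rewrite /quad raddf_sum /=.
under eq_bigr => i _ do rewrite rmorphM /= !linsubX /linform mulr_suml.
rewrite exchange_big /=; apply: eq_bigr => a _.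
under eq_bigr => i _.
  rewrite mulr_sumr; under eq_bigr => b _ do
    rewrite -scalerAl -scalerAr scalerA.
  over.
rewrite exchange_big /=.
under eq_bigr => b _ do rewrite -scaler_suml MM.
rewrite (bigD1 (s a)) //= eqxx scale1r big1 ?addr0 // => j ne.
by rewrite (negbTE ne) scale0r.
Qed.

Lemma wlt_linsub n k (M : 'I_n -> 'I_k -> C) d p :
  wlt (fun=> 1%N) d p -> wlt (fun=> 1%N) d (linsub M p).
Proof.
move=> /allP wp; rewrite /linsub /mmap big_seq; apply: wlt_sum => m /wp /= md.
apply: (@wlt_mono _ _ _ (0 + (wt (fun=> 1%N) m).+1)%N) => //.
apply: wltM; first exact: wltC.
rewrite /mmap1 /wt; elim/big_rec2: _ => [|i a q _ IH].
  by rewrite -(mpolyC1 k C); exact: wltC.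
rewrite -addnS; apply: wltM => //; apply: wltE.
apply: wlt_sum => j _; apply: wltZ; exact: wltXU.
Qed.

Definition ray n (v : 'I_n -> C) (p : mpoly n C) : {poly C} :=
  mmap (@polyC C) (fun i => v i *: 'X) p.
HB.instance Definition _ n (v : 'I_n -> C) :=
  GRing.RMorphism.copy (ray v) (mmap (@polyC C) (fun i => v i *: 'X)).

Lemma ray_linsub n k (M : 'I_n -> 'I_k -> C) v p :
  ray v (linsub M p) = ray (fun i => \sum_a M i a * v a) p.
Proof.
elim/mpoly_ring_ind: p => [c|i|p q Ep Eq|p q Ep Eq].
- by rewrite linsubC /ray !mmapC.
- rewrite linsubX /linform raddf_sum /= /ray mmapXU scaler_suml.
  by apply: eq_bigr => a _; rewrite mmapZ mmapXU /= mul_polyC scalerA.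
- by rewrite !rmorphD /= Ep Eq.
- by rewrite !rmorphM /= Ep Eq.
Qed.

Lemma coef_ray n (v : 'I_n -> C) p k :
  (ray v p)`_k = \sum_(m <- msupp p | mdeg m == k)
     mcoeff m p * \prod_i v i ^+ m i.
Proof.
rewrite /ray /mmap coef_sum [RHS]big_mkcond /=; apply: eq_bigr => m _.
have -> : mmap1 (fun i => v i *: 'X) m = (\prod_i v i ^+ m i) *: 'X^(mdeg m).
  rewrite /mmap1 mdegE -prodrXr -scaler_prod; apply: eq_bigr => i _.
  by rewrite exprZn.
rewrite coefCM coefZ coefXn eq_sym; case: eqP => _; by rewrite ?mulr1 ?mulr0.
Qed.

(** Lines through the origin carry the degree [k] part of [p] through a linear
    substitution, which maps lines to lines. *)
Lemma coef_ray_top n (v : 'I_n -> C) p k :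
  (ray v p)`_k = meval v (pihomog mdeg k p).
Proof.
rewrite coef_ray /pihomog raddf_sum /=; apply: eq_bigr => m _.
by rewrite mevalZ mevalX.
Qed.

Lemma coef_ray_delta n (i : 'I_n) (p : mpoly n C) k :
  (ray (fun j => (j == i)%:R) p)`_k = mcoeff (mnm_muln (mnm1 i) k) p.
Proof.
rewrite coef_ray; set m0 := mnm_muln _ _.
have E m : mdeg m == k -> \prod_j ((j == i)%:R : C) ^+ m j = (m == m0)%:R.
  move=> /eqP dm; rewrite (bigD1 i) //= eqxx expr1n mul1r.
  have [->|ne] := eqVneq m m0.
    rewrite big1 // => j ne; rewrite /m0 mulmnE mnm1E [i == j]eq_sym (negbTE ne).
    by rewrite mul0n expr0.
  have [j ji mj] : exists2 j, j != i & m j != 0%N.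
    apply/exists_inP; apply: contraNT ne => /exists_inPn h; apply/eqP/mnmP => j.
    rewrite /m0 mulmnE mnm1E; case: eqVneq => [<-|ij]; last first.
      by rewrite mul0n; apply/eqP/negPn/h; rewrite unfold_in /= eq_sym.
    rewrite mul1n -dm mdegE (bigD1 i) //= big1 ?addn0 // => a ai.
    by apply/eqP/negPn/h.
  by rewrite (bigD1 j) //= (negbTE ji) expr0n (negbTE mj) mul0r.
rewrite (eq_bigr (fun m => mcoeff m p * (m == m0)%:R)); last first.
  by move=> m /E ->.
have dm0 : mdeg m0 == k by rewrite mdegMn mdeg1 mul1n.
have [m0p|m0p] := boolP (m0 \in msupp p).
  rewrite -big_filter (bigD1_seq m0) /=; first last.
  - by rewrite filter_uniq // msupp_uniq.
  - by rewrite mem_filter dm0.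
  by rewrite eqxx mulr1 big1 ?addr0 // => m /negbTE ->; rewrite mulr0.
rewrite (memN_msupp_eq0 m0p) big_seq_cond big1 // => m /andP[mp _].
case: eqP => [e|_]; last by rewrite mulr0.
by rewrite e (negbTE m0p) in mp.
Qed.

End Substitution.

(** * Points where a polynomial does not vanish *)

Section Evaluation.
Variable C : numFieldType.

Lemma poly_infinite_roots (p : {poly C}) : (forall t, p.[t] = 0) -> p = 0.
Proof.
move=> h; apply/eqP; apply: contraT => p0.
pose rs : seq C := [seq i%:R | i <- iota 0 (size p)].
have A : all (root p) rs by apply/allP => t _; apply/rootP.
have U : uniq rs.
  by rewrite map_inj_uniq ?iota_uniq // => i j /eqP; rewrite eqr_nat => /eqP.
by have := max_poly_roots p0 A U; rewrite size_map size_iota ltnn.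
Qed.

Variable n : nat.
Implicit Types p : mpoly n C.

Definition line (v : 'I_n -> C) i p : {poly C} :=
  mmap (@polyC C) (fun j => (v j)%:P + (i == j)%:R *: 'X) p.
HB.instance Definition _ v i := GRing.RMorphism.copy (line v i)
  (mmap (@polyC C) (fun j => (v j)%:P + (i == j)%:R *: 'X)).

Lemma lineC v i c : line v i (mpolyC n c) = c%:P.
Proof. exact: mmapC. Qed.

Lemma lineX v i j : line v i 'x_j = (v j)%:P + (i == j)%:R *: 'X.
Proof. exact: mmapXU. Qed.

Lemma deriv_line v i p : (line v i p)^`() = line v i (mderiv i p).
Proof.
elim/mpoly_ring_ind: p => [c|j|p q Ep Eq|p q Ep Eq].
- by rewrite lineC derivC mderivC raddf0.
- rewrite lineX derivD derivC derivZ derivX add0r mderivXU.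
  by case: (i == j); rewrite ?rmorph1 ?rmorph0 ?scale1r ?scale0r.
- by rewrite mderivD !rmorphD /= derivD Ep Eq.
- by rewrite mderivM rmorphD !rmorphM /= derivM Ep Eq.
Qed.

Lemma horner_line v i p t :
  (line v i p).[t] = meval (fun j => v j + (i == j)%:R * t) p.
Proof.
elim/mpoly_ring_ind: p => [c|j|p q Ep Eq|p q Ep Eq].
- by rewrite lineC hornerC mevalC.
- by rewrite lineX mevalXU !hornerE.
- by rewrite mevalD rmorphD hornerD Ep Eq.
- by rewrite mevalM rmorphM hornerM Ep Eq.
Qed.

(** If [p] vanishes everywhere so do its partial derivatives, which have
    smaller degree. *)
Lemma mpoly_nonvanishing p : p != 0 -> exists v, meval v p != 0.
Proof.
move=> p0; apply: contrapT => nv.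
have {nv} : forall v, meval v p = 0.
  by move=> v; apply: contrapT => /eqP pv; apply: nv; exists v.
move: p0; have [d] : exists d, wlt (fun=> 1%N) d p.
  exists (mmeasure mdeg p); apply/allP => m /= mp.
  have -> : wt (fun=> 1%N) m = mdeg m.
    by rewrite mdegE; apply: eq_bigr => i _; rewrite muln1.
  exact: mmeasure_mnm_lt.
elim: d p => [|d IH] p wp p0 pv; first by rewrite (wlt0 wp) eqxx in p0.
have D i : mderiv i p = 0.
  apply: contraNeq p0 => di; exfalso; move/negP: di; apply.
  apply: contraT => di; have := IH _ _ di.
  have := wlt_mderiv i wp; rewrite subn1 /= => wd /(_ wd) h.
  suff /h : forall v, meval v (mderiv i p) = 0 by [].
  move=> v; have E : line v i p = 0.
    by apply: poly_infinite_roots => t; rewrite horner_line.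
  have := deriv_line v i p; rewrite E deriv0 => /esym /(congr1 (horner^~ 0)).
  rewrite horner_line horner0 => <-; apply: meval_eq => j.
  by rewrite mulr0 addr0.
have Ep : p = mpolyC n (mcoeff mnm0 p).
  apply/mpolyP => m; rewrite mcoeffC.
  have [->|m0] := eqVneq m mnm0; first by rewrite mulr1.
  rewrite mulr0; have [i mi] : exists i, m i != 0%N.
    apply/existsP; apply: contraNT m0 => /existsPn h; apply/eqP/mnmP => i.
    by rewrite mnm0E; apply/eqP/negPn/h.
  have := congr1 (mcoeff (mnm_sub m (mnm1 i))) (D i).
  rewrite mcoeff_mderiv mcoeff0 submK; last by rewrite lep1mP.
  by move=> /eqP; rewrite mulrn_eq0 /= => /eqP.
by have := pv (fun=> 0); rewrite Ep mevalC => e; rewrite Ep e mpolyC0 eqxx in p0.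
Qed.

Lemma meval_indep i p v v' : mderiv i p = 0 ->
  (forall j, j != i -> v j = v' j) -> meval v p = meval v' p.
Proof.
move=> dp vv; rewrite !mevalE big_seq [RHS]big_seq; apply: eq_bigr => m mp.
congr (_ * _); apply: eq_bigr => j _; have [->|/vv -> //] := eqVneq j i.
suff -> : m i = 0%N by rewrite !expr0.
apply: contraTeq mp => mi; rewrite mcoeff_msupp negbK.
have := congr1 (mcoeff (mnm_sub m (mnm1 i))) dp.
rewrite mcoeff_mderiv mcoeff0 submK; last by rewrite lep1mP.
by move=> /eqP; rewrite mulrn_eq0.
Qed.

End Evaluation.

(** * Expansion in powers of the quadratic form *)

Section Expansion.
Variables (C : numFieldType) (n : nat).
Local Notation poly_n := (mpoly n.+1 C).
Implicit Types p q r : poly_n.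

(** Degree at most one in the first variable: normal forms modulo [quad id],
    since ['x_ord0 ^+ 2] can be traded for [quad id] minus the other squares. *)
Definition reduced p := mderiv ord0 (mderiv ord0 p) = 0.

Definition expandable p := exists r : {poly poly_n},
  (forall j, reduced r`_j) /\ p = r.[quad C id].

Lemma reducedD p q : reduced p -> reduced q -> reduced (p + q).
Proof. by rewrite /reduced !mderivD => -> ->; rewrite addr0. Qed.

Lemma reduced0 : reduced 0. Proof. by rewrite /reduced !mderiv0. Qed.

Lemma expandable_reduced p : reduced p -> expandable p.
Proof.
move=> rp; exists p%:P; split; last by rewrite hornerC.
by move=> j; rewrite coefC; case: eqP => _ //; exact: reduced0.
Qed.

Lemma expandableD p q : expandable p -> expandable q -> expandable (p + q).
Proof.
move=> [r [rr ->]] [t [rt ->]]; exists (r + t); rewrite hornerD; split=> // j.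
by rewrite coefD; exact: reducedD.
Qed.

Lemma expandable_quadM p : expandable p -> expandable (quad C id * p).
Proof.
move=> [r [rr ->]]; exists (r * 'X); split; last by rewrite hornerMX mulrC.
move=> j; by rewrite coefMX; case: eqP => _ //; exact: reduced0.
Qed.

Lemma expandable_X i p : reduced p -> expandable ('x_i * p).
Proof.
move=> rp; have [->|i0] := eqVneq i ord0; last first.
  apply: expandable_reduced; rewrite /reduced !mderivM mderivXU.
  by rewrite eq_sym (negbTE i0) mul0r add0r mderivM mderivXU eq_sym (negbTE i0)
    mul0r add0r rp mulr0.
pose b := mderiv ord0 p; pose a := p - 'x_ord0 * b.
pose q := \sum_(j < n.+1 | j != ord0) 'x_j * 'x_j : poly_n.
have Q : quad C id = 'x_ord0 * 'x_ord0 + q by rewrite /quad (bigD1 ord0).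
have -> : 'x_ord0 * p = ('x_ord0 * a - q * b) + quad C id * b.
  by rewrite Q /a; ring.
have db : mderiv ord0 b = 0 by [].
have da : mderiv ord0 a = 0.
  by rewrite /a mderivB mderivM mderivXU eqxx db mulr0 addr0 mul1r subrr.
have dq : mderiv ord0 q = 0.
  rewrite /q raddf_sum big1 // => j j0; rewrite /= mderivM mderivXU.
  by rewrite eq_sym (negbTE j0) mul0r mulr0 addr0.
apply: expandableD; last first.
  apply: expandable_quadM; apply: expandable_reduced.
  by rewrite /reduced db mderiv0.
apply: expandable_reduced; rewrite /reduced.
have -> : mderiv ord0 ('x_ord0 * a - q * b) = a.
  rewrite mderivB !mderivM mderivXU eqxx da db dq.
  by rewrite !mulr0 mul0r !addr0 subr0 mul1r.
exact: da.
Qed.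

Lemma expandableT p : expandable p.
Proof.
have XM i q : expandable q -> expandable ('x_i * q).
  move=> [r [rr ->]]; rewrite horner_coef mulr_sumr.
  apply: (big_ind expandable) => [||j _].
  - exact/expandable_reduced/reduced0.
  - exact: expandableD.
  - rewrite mulrA; elim: (val j) {2}(val j) (rr j) => [|k IH] l rl.
      by rewrite expr0 mulr1; exact: expandable_X.
    rewrite exprS mulrCA; apply: expandable_quadM; exact: IH.
elim/mpolyind: p => [|c m p _ _ ep].
  exact/expandable_reduced/reduced0.
apply: expandableD => //; rewrite -mul_mpolyC mpolyXE_id mulrC.
rewrite [index_enum _]lock; elim: (locked _) => [|i l IH].
  rewrite big_nil mul1r; apply: expandable_reduced.
  by rewrite /reduced mderivC mderiv0.
rewrite big_cons -mulrA; elim: (m i) => [|k IHk]; first by rewrite expr0 mul1r.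
by rewrite exprS -mulrA; exact: XM.
Qed.

End Expansion.

(** * Isotropic vectors and isotropic coordinates *)

Local Notation o1 := (lift ord0 ord0).

(** Write [t = a + 'x_ord0 * b] with [a] and [b] free of the first variable. Over a
    generic point of the other coordinates lie two isotropic vectors, with opposite
    nonzero first coordinates; if [t] vanished at both, so would [a] and [b]. *)
Lemma isotropic_nonvanishing (C : numClosedFieldType) n (t : mpoly n.+2 C) :
  t != 0 -> reduced t ->
  exists z : 'I_n.+2 -> C,
    [/\ \sum_i z i * z i = 0, z o1 != 0 & meval z t != 0].
Proof.
move=> t0 rt; pose b := mderiv ord0 t; pose a := t - 'x_ord0 * b.
have db : mderiv ord0 b = 0 by [].
have da : mderiv ord0 a = 0.
  by rewrite /a mderivB mderivM mderivXU eqxx db mulr0 addr0 mul1r subrr.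
have E : t = a + 'x_ord0 * b by rewrite /a subrK.
pose q : mpoly n.+2 C := \sum_(i | i != ord0) 'x_i * 'x_i.
have qE v : meval v q = \sum_(i | i != ord0) v i * v i.
  by rewrite /q raddf_sum; apply: eq_bigr => i _; rewrite /= mevalM mevalXU.
have q0 : q != 0.
  apply/eqP => /(congr1 (meval (fun i => (i == o1)%:R : C))).
  rewrite meval0 qE (bigD1 o1) //= mulr1 big1 => [|i /andP[_ /negbTE ->]].
    by move/eqP; rewrite addr0 oner_eq0.
  by rewrite mulr0.
pose g := if a != 0 then a else b.
have g0 : g != 0.
  rewrite /g; case: ifP => // /negbFE/eqP a0.
  by apply: contraNneq t0 => b0; rewrite E a0 b0 mulr0 addr0.
have x0 : ('x_o1 : mpoly n.+2 C) != 0.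
  apply/eqP => /(congr1 (mcoeff (mnm1 o1))) /eqP.
  by rewrite mcoeffXU eqxx mcoeff0 oner_eq0.
have [v] := mpoly_nonvanishing (mulf_neq0 (mulf_neq0 x0 q0) g0).
rewrite !mevalM !mulf_eq0 !negb_or mevalXU => /andP[/andP[v1 vq] vg].
pose s := sqrtC (- meval v q); pose z e j := if j == ord0 then e else v j.
have sn0 : s != 0 by rewrite sqrtC_eq0 oppr_eq0.
have iso e : e ^+ 2 = - meval v q -> \sum_i z e i * z e i = 0.
  move=> e2; rewrite (bigD1 ord0) //= {1 2}/z eqxx -expr2 e2 qE addrC.
  apply/eqP; rewrite subr_eq0; apply/eqP; apply: eq_bigr => i /negbTE ne.
  by rewrite /z ne.
have ev e : meval (z e) t = meval v a + e * meval v b.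
  rewrite {1}E mevalD mevalM mevalXU {2}/z eqxx.
  by congr (_ + _ * _); apply: (@meval_indep _ _ ord0) => // j /negbTE ne;
    rewrite /z ne.
have [h|h] := eqVneq (meval (z s) t) 0; last first.
  by exists (z s); split=> //; apply: iso; rewrite sqrtCK.
exists (z (- s)); split=> //; first by apply: iso; rewrite sqrrN sqrtCK.
apply: contraNneq vg => h'; move: h h'; rewrite !ev => h h'.
have a0 : meval v a = 0.
  have : meval v a *+ 2 = 0 by rewrite -[RHS](addr0 0) -{1}h -h'; ring.
  by move/eqP; rewrite mulrn_eq0 /= => /eqP.
move: h; rewrite a0 add0r => /eqP; rewrite mulf_eq0 (negbTE sn0) /= => /eqP b0.
by rewrite /g; case: ifP; rewrite ?a0 ?b0.
Qed.

Definition swap01 n (i : 'I_n.+2) : 'I_n.+2 :=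
  if i == ord0 then o1 else if i == o1 then ord0 else i.

Lemma swap01K n : involutive (@swap01 n).
Proof.
move=> i; rewrite /swap01.
by case: (eqVneq i ord0) => [->|i0] //=; case: (eqVneq i o1) => [->|i1] //=;
  rewrite (negbTE i0) (negbTE i1).
Qed.

Definition swap_mx (C : comNzRingType) n : 'M[C]_n.+2 :=
  \matrix_(i, j) (j == swap01 i)%:R.

Section Frame.
Variables (C : numClosedFieldType) (n : nat).
Local Notation G := (swap_mx C n).

(** The change of variables [x_0 = z + w / 2], [x_1 = e (z - w / 2)]; when
    [e ^ 2 = -1] it gives [x_0 ^ 2 + x_1 ^ 2 = 2 z w]. *)
Definition iso_mx (e : C) : 'M[C]_n.+2 := \matrix_(i, a)
  if i == ord0 then (a == ord0)%:R + (a == o1)%:R / 2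
  else if i == o1 then e * ((a == ord0)%:R - (a == o1)%:R / 2)
  else (i == a)%:R.

Lemma iso_mx_gram e : e ^+ 2 = -1 -> (iso_mx e)^T *m iso_mx e = G.
Proof.
move=> e2; apply/matrixP => a b; rewrite !mxE.
rewrite (bigD1 ord0) //= (bigD1 o1) //= !mxE /=.
rewrite mulrACA -expr2 e2.
have -> : \sum_(i < n.+2 | (i != ord0) && (i != o1))
    (iso_mx e)^T a i * iso_mx e i b =
    ((a != ord0) && (a != o1) && (a == b))%:R.
  have [/andP[a0 a1]|na] /= := boolP ((a != ord0) && (a != o1)).
    rewrite (bigD1 a) /= ?a0 ?a1 // big1 => [|i /andP[/andP[i0 i1] ia]].
      by rewrite !mxE (negbTE a0) (negbTE a1) eqxx mul1r addr0.
    by rewrite !mxE (negbTE i0) (negbTE i1) (negbTE ia) mul0r.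
  rewrite big1 // => i /andP[i0 i1]; rewrite !mxE (negbTE i0) (negbTE i1).
  have [ia|_] := eqVneq i a; last by rewrite mul0r.
  by rewrite -ia i0 i1 in na.
rewrite /swap01; case: (eqVneq a ord0) => [->|a0] /=.
  by case: (eqVneq b ord0) => [->|_]; [|case: (b == o1)];
    rewrite /= ?mulr0n ?mulr1n; field.
case: (eqVneq a o1) => [->|a1] /=.
  by case: (eqVneq b ord0) => [->|_]; [|case: (b == o1)];
    rewrite /= ?mulr0n ?mulr1n; field.
by rewrite [b == a]eq_sym /= ?mulr0n; field.
Qed.

Lemma trmx_swap : G^T = G.
Proof.
apply/matrixP => a b; rewrite !mxE -(inj_eq (inv_inj (@swap01K n))) swap01K.
by rewrite eq_sym.
Qed.

Lemma mul_swap : G *m G = 1%:M.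
Proof.
apply/matrixP => a b; rewrite !mxE (bigD1 (swap01 a)) //= !mxE eqxx mul1r.
rewrite swap01K big1 ?addr0 => [|i ne]; first by rewrite eq_sym.
by rewrite mxE (negbTE ne) mul0r.
Qed.

(** Isotropic coordinates whose [w]-axis is spanned by the isotropic vector [z].
    Let [z0] be the [w]-axis of [iso_mx e]. The reflection in the hyperplane
    orthogonal to [z - z0] exchanges [z0] and [z] as soon as [z . z0 != 0]; as
    [z o1 != 0], this holds for one of the two square roots [e] of [-1]. *)
Lemma isotropic_frame (z : 'I_n.+2 -> C) :
  \sum_i z i * z i = 0 -> z o1 != 0 ->
  exists T : 'M[C]_n.+2, T^T *m T = G /\ forall i, T i o1 = z i.
Proof.
move=> zz z1; pose Z : 'cV[C]_n.+2 := \col_i z i.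
pose Z0 e := col o1 (iso_mx e); pose dot (u v : 'cV[C]_n.+2) : C := (u^T *m v) 0 0.
have dotE u v : u^T *m v = (dot u v)%:M by rewrite [LHS]mx11_scalar.
have dotC u v : dot u v = dot v u.
  by rewrite /dot !mxE; apply: eq_bigr => i _; rewrite !mxE mulrC.
have dotB u u' x : dot (u - u') x = dot u x - dot u' x.
  by rewrite /dot !mxE -sumrB; apply: eq_bigr => i _; rewrite !mxE mulrBl.
have Z00 e : e ^+ 2 = -1 -> dot (Z0 e) (Z0 e) = 0.
  move=> /iso_mx_gram /matrixP/(_ o1 o1); rewrite !mxE /= => E.
  by rewrite /dot mxE -[RHS]E; apply: eq_bigr => i _; rewrite !mxE.
have dZ0 e : dot Z (Z0 e) = z ord0 / 2 - e * (z o1 / 2).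
  rewrite /dot mxE (bigD1 ord0) //= (bigD1 o1) //= !mxE /= big1 => [|i].
    by rewrite ?mulr0n; ring.
  by move=> /andP[i0 i1]; rewrite !mxE (negbTE i0) (negbTE i1) mulr0n mulr0.
have [e e2 dn0] : exists2 e : C, e ^+ 2 = -1 & dot Z (Z0 e) != 0.
  have [h|h] := eqVneq (dot Z (Z0 'i)) 0; last by exists 'i; rewrite ?sqrCi.
  exists (- 'i); first by rewrite sqrrN sqrCi.
  apply: contraNneq z1 => h'; move: h h'; rewrite !dZ0 => h h'.
  have : 'i * z o1 = 0.
    have -> : 'i * z o1 = (z ord0 / 2 - - 'i * (z o1 / 2)) -
      (z ord0 / 2 - 'i * (z o1 / 2)) by field.
    by rewrite h h' subrr.
  by move/eqP; rewrite mulf_eq0 (negbTE (neq0Ci _)).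
pose d := dot Z (Z0 e); pose v := Z - Z0 e.
have ZZ : dot Z Z = 0.
  by rewrite /dot mxE -[RHS]zz; apply: eq_bigr => i _; rewrite !mxE.
have vv : dot v v = - (d *+ 2).
  rewrite /v dotB ![dot _ (Z - _)]dotC !dotB ZZ Z00 // [dot (Z0 e) Z]dotC.
  by rewrite -/d; ring.
have vz : dot v (Z0 e) = d.
  by rewrite /v dotB Z00 // subr0.
pose R := 1%:M + d^-1 *: (v *m v^T).
have RR : R^T *m R = 1%:M.
  have RT : R^T = R by rewrite /R linearD linearZ /= trmx1 trmx_mul trmxK.
  rewrite RT /R mulmxDl !mulmxDr !mul1mx mulmx1 -!scalemxAl -!scalemxAr.
  rewrite !mulmxA -[v *m _ *m v]mulmxA dotE vv scalar_mxC mul_scalar_mx -scalemxAl.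
  rewrite !scalerA -addrA -!scalerDl -[RHS]addr0; congr (_ + _).
  rewrite (_ : _ + _ = 0) ?scale0r //; field; exact: dn0.
exists (R *m iso_mx e); split.
  by rewrite trmx_mul -mulmxA [X in _ *m X]mulmxA RR mul1mx iso_mx_gram.
move=> i; have -> : (R *m iso_mx e) i o1 = (R *m Z0 e) i ord0.
  by rewrite !mxE; apply: eq_bigr => j _; rewrite !mxE.
rewrite /R mulmxDl mul1mx -scalemxAl -mulmxA dotE vz scalar_mxC mul_scalar_mx.
by rewrite scalerA mulVf // scale1r /v addrC subrK mxE.
Qed.

End Frame.

(** * Exact division by a polynomial *)

Section Decomposition.
Variable C : numClosedFieldType.

Lemma wt_mdeg n (m : multinom n) : wt (fun=> 1%N) m = mdeg m.
Proof. by rewrite mdegE; apply: eq_bigr => i _; rewrite muln1. Qed.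

Lemma mcoeff_pihomog n k (p : mpoly n C) m :
  mcoeff m (pihomog mdeg k p) = if mdeg m == k then mcoeff m p else 0.
Proof.
rewrite /pihomog raddf_sum /=.
rewrite (eq_bigr (fun m' => mcoeff m' p * (m' == m)%:R)) => [|m' _]; last first.
  by rewrite mcoeffZ mcoeffX.
have [mp|mp] := boolP (m \in msupp p); last first.
  rewrite (memN_msupp_eq0 mp) if_same big_seq_cond big1 // => m' /andP[m'p _].
  case: eqP => [e|_]; last by rewrite mulr0.
  by rewrite -e m'p in mp.
rewrite big_mkcond (bigD1_seq m) ?msupp_uniq //= eqxx mulr1 big1 ?addr0 //.
by move=> m' /negbTE ->; rewrite mulr0 if_same.
Qed.

Lemma pihomog_reduced n k (p : mpoly n.+1 C) :
  reduced p -> reduced (pihomog mdeg k p).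
Proof.
move=> rp; apply/mpolyP => m; rewrite !mcoeff_mderiv mcoeff_pihomog mcoeff0.
case: ifP => _; last by rewrite !mul0rn.
by rewrite -!mcoeff_mderiv rp mcoeff0.
Qed.

(** The second half bounds [N] by the largest polyharmonic degree of a product
    of [p] with a harmonic polynomial. *)
Definition sharp_division n s (p : mpoly n C) N :=
  (forall f, exists q, iter N (lap s) (f - p * q) = 0) /\
  (exists2 h, lap s h = 0 & iter N (lap s) (p * h) != 0).

Lemma lead_sharp_division n s (w : 'I_n -> nat) kap i (p : mpoly n C) (c : C) J k :
  (forall i, w i + w (s i) = kap)%N -> involutive s -> (0 < n)%N ->
  (0 < kap)%N -> c != 0 ->
  wlt w (J * kap + k * w i) (p - c *: (quad C s ^+ J * 'x_i ^+ k)) ->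
  @lap_division C n w s 1 (w i) 'x_i -> lap s ('x_(s i) ^+ k : mpoly n C) = 0 ->
  sharp_division s p (J + k).
Proof.
move=> ws sK n0 k0 c0 wp di hi; split; last first.
  exists ('x_(s i) ^+ k) => //.
  have [c' c'0 ->] := lead_test ws sK n0 c0 wp hi.
  by rewrite mpolyC_eq0.
have dq : lap_division w s 1 kap (quad C s) by exact: quad_division.
have dx := lap_divisionXM k (coord_raises sK i) di (@lap_division1 C n w s).
have := lap_divisionXM J (quad_raises sK) dq dx.
rewrite mulr1 !addn0 => dp f.
have wf : wlt w (\max_(m <- msupp f) (wt w m).+1) f.
  apply/allP => m mf /=; by rewrite (bigD1_seq m) ?msupp_uniq //= leq_max leqnn.
by have [q _ fq] := lead_division c0 wp dp wf; exists q.
Qed.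

(** In one variable the leading monomial of [p] is [quad ^+ J * 'x_ord0 ^+ k] with
    [k <= 1], and weights are degrees. *)
Lemma sharp_division1 (p : mpoly 1 C) :
  p != 0 -> exists N, sharp_division id p N.
Proof.
move=> p0; pose m0 := mlead p; pose d := mdeg m0.
have mE (m : multinom 1) : m = mnm_muln (mnm1 ord0) (mdeg m).
  apply/mnmP => i; rewrite mulmnE mnm1E !ord1 eqxx mul1n mdegE.
  by rewrite big_ord1.
have c0 : mcoeff m0 p != 0 by rewrite mleadc_eq0.
have wE m : wt (fun=> 1%N) m = mdeg m by exact: wt_mdeg.
have q2 : quad C (@id 'I_1) = 'x_ord0 ^+ 2 by rewrite /quad big_ord1 expr2.
exists (d./2 + odd d)%N.
apply: (@lead_sharp_division _ _ (fun=> 1%N) 2 ord0 p (mcoeff m0 p)) => //.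
- have e : (d./2 * 2 + odd d = d)%N by rewrite addnC muln2 odd_double_half.
  rewrite q2 -exprM -exprD muln1 [(2 * _)%N]mulnC e mpolyXn -(mE m0).
  apply/allP => m; rewrite wE mcoeff_msupp => mp.
  have m_m0 : m != m0.
    by apply: contraNneq mp => ->; rewrite mcoeffB mcoeffZ mcoeffX eqxx mulr1
      subrr.
  have : mcoeff m p != 0.
    move: mp; rewrite mcoeffB mcoeffZ mcoeffX [m0 == m]eq_sym (negbTE m_m0).
    by rewrite mulr0n mulr0 subr0.
  rewrite -mcoeff_msupp => /msupp_le_mlead/lemc_mdeg; rewrite leq_eqVlt.
  case/orP => // /eqP dm; case/eqP: m_m0.
  by rewrite (mE m) [RHS]mE dm.
- move=> e f wf.
  have [q [b E]] : exists q b, f = 'x_ord0 * q + mpolyC 1 b.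
    elim/mpolyind: f {wf} => [|b m f _ _ [q [b' ->]]].
      by exists 0, 0; rewrite mulr0 mpolyC0 addr0.
    have [m00|m00] := eqVneq m mnm0.
      exists q, (b + b'); rewrite m00 mpolyX0 mpolyCD -[b *: 1]mul_mpolyC mulr1.
      by ring.
    exists (b *: mpolyX C (mnm_sub m (mnm1 ord0)) + q), b'.
    rewrite mulrDr addrA -scalerAr -mpolyXD addmC submK //.
    rewrite lep1mP; apply: contraNneq m00 => m00; apply/eqP/mnmP => i.
    by rewrite ord1 mnm0E.
  exists q; last first.
    by rewrite /= E addrC addKr lapC.
  apply/wltP => m qm.
  have : mcoeff (mnm_add (mnm1 ord0) m) f != 0.
    rewrite E mcoeffD mcoeffC mulrC mcoeffMX.
    rewrite (_ : (mnm_add _ _ == mnm0) = false) ?mulr0n ?mulr0 ?addr0 //.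
    by apply/eqP => /(congr1 mdeg); rewrite mdegD mdeg1 mdeg0.
  by move/wltP: wf => wf /wf; rewrite wtD wt1; lia.
- case: (odd d); last by rewrite expr0 -(mpolyC1 1 C) lapC.
  by rewrite expr1 lapX.
Qed.

(** Expand [p] in powers of [quad] with reduced coefficients [r`_j] of degree
    [mu j], and choose [J] maximizing first [mu j + j], then [j]. In isotropic
    coordinates whose [w]-axis is an isotropic vector at which the top form of
    [r`_J] does not vanish, the polynomial [p] acquires the leading form
    [quad ^+ J * w ^+ mu J]. *)
Lemma sharp_division2 n (p : mpoly n.+2 C) :
  p != 0 -> exists N, sharp_division id p N.
Proof.
move=> p0; have [r [rr Ep]] := expandableT p.
have r0 : r != 0 by apply: contraNneq p0 => r0; rewrite Ep r0 horner0.
pose D := size r; pose mu j := (mmeasure mdeg r`_j).-1.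
have D0 : (0 < D)%N by rewrite lt0n size_poly_eq0.
(* lexicographic comparison of [(mu j + j, j)], encoded in one number as [j < D] *)
pose K (j : 'I_D) := ((2 * D).+1 * (mu j + j) + j)%N.
have lt1 : (D.-1 < D)%N by rewrite prednK.
have l0 : r`_(Ordinal lt1) != 0 by rewrite -/(lead_coef r) lead_coef_eq0.
have [J rJ maxJ] := @arg_maxnP _ (Ordinal lt1) (fun j => r`_j != 0) K l0.
have ltK (j : 'I_D) : r`_j != 0 -> j != J -> (K j < K J)%N.
  move=> rj jJ; have le : (K j <= K J)%N by exact: maxJ.
  rewrite ltn_neqAle le andbT; apply: contra_neq jJ => e.
  apply: val_inj; move: e {le} (ltn_ord j) (ltn_ord J); rewrite /K /=.
  move: (mu j + j)%N (mu J + J)%N => a b e jD JD.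
  have [ab|ab|ab] := ltngtP a b; [exfalso|exfalso|by move: e; rewrite ab; lia].
  - have : ((2 * D).+1 * a.+1 <= (2 * D).+1 * b)%N by rewrite leq_mul2l ab orbT.
    rewrite mulnS; lia.
  - have : ((2 * D).+1 * b.+1 <= (2 * D).+1 * a)%N by rewrite leq_mul2l ab orbT.
    rewrite mulnS; lia.
have degr (j : nat) : r`_j != 0 -> wlt (fun=> 1%N) (mu j).+1 r`_j.
  move=> rj; apply/allP => m mr; rewrite wt_mdeg /mu.
  by rewrite -mpolySpred //; exact: mmeasure_mnm_lt.
have t0 : pihomog mdeg (mu J) r`_J != 0.
  apply/eqP => /(congr1 (mcoeff (mlead r`_J))) /eqP.
  rewrite mcoeff_pihomog mcoeff0 /mu -mlead_deg //= eqxx.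
  by rewrite mleadc_eq0 (negbTE rJ).
have [z [zz z1 zt]] :=
  isotropic_nonvanishing t0 (pihomog_reduced (mu J) (rr J)).
have [T [TT Tz]] := isotropic_frame zz z1.
pose T' := swap_mx C n *m T^T; pose s := @swap01 n.
have sK : involutive s := @swap01K n.
have T'T : T' *m T = 1%:M by rewrite /T' -mulmxA TT mul_swap.
have TT' : T *m T' = 1%:M by exact: mulmx1C.
have p'K q : linsub T' (linsub T q) = q.
  rewrite linsub_comp; apply: linsub_id => i j.
  by move/matrixP: TT' => /(_ i j); rewrite !mxE.
have lapT' q : lap id (linsub T' q) = linsub T' (lap s q).
  apply: lap_linsub => a b.
  have : T' *m T'^T = swap_mx C n.
    rewrite {2}/T' trmx_mul trmxK trmx_swap mulmxA T'T mul1mx //.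
  by move/matrixP => /(_ a b); rewrite !mxE => <-; apply: eq_bigr => i _; rewrite !mxE.
have Tquad : linsub T (quad C id) = quad C s.
  apply: linsub_quad => a b.
  by move/matrixP: TT => /(_ a b); rewrite !mxE => <-; apply: eq_bigr => i _; rewrite !mxE.
(* Up to the factor [D], a perturbation of the weights 0, 1, 2 of [z], [y], [w], for
   which [quad ^+ j * w ^+ mu j] has weight [2 * (j + mu j)]; the perturbed weight
   is [K j], which breaks ties. *)
pose w (i : 'I_n.+2) :=
  if i == ord0 then 1%N else if i == o1 then (2 * D).+1 else D.+1.
have ws i : (w i + w (s i) = (2 * D).+2)%N.
  rewrite /w /s /swap01; case: (eqVneq i ord0) => [|i0] /=; first by lia.
  case: (eqVneq i o1) => [|i1] /=; first by lia.
  by rewrite (negbTE i0) (negbTE i1); lia.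
have w1 : w o1 = (2 * D).+1 by [].
have w_le (m : multinom n.+2) : (wt w m + (mdeg m - m o1) * D <=
    mdeg m * (2 * D).+1)%N.
  rewrite mdegE /wt (bigD1 o1) //= [X in ((X - _) * _)%N](bigD1 o1) //= addKn w1.
  rewrite [X in (_ <= X * _)%N](bigD1 o1) //= mulnDl -addnA leq_add2l !big_distrl.
  rewrite -big_split /=; apply: leq_sum => i i1.
  by rewrite /w (negbTE i1); case: ifP => _; nia.
pose c := mcoeff (mnm_muln (mnm1 o1) (mu J)) (linsub T r`_J).
have c0 : c != 0.
  rewrite /c -coef_ray_delta ray_linsub coef_ray_top.
  rewrite (_ : (fun i => _) = z) //; apply/funext => i.
  rewrite (bigD1 o1) //= ?eqxx mulr1 Tz big1 ?addr0 // => j /negbTE ->.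
  by rewrite mulr0.
have Ep' : linsub T p = \sum_(j < D) linsub T r`_j * quad C s ^+ j.
  rewrite Ep horner_coef raddf_sum /=; apply: eq_bigr => j _.
  by rewrite rmorphM rmorphXn /= Tquad.
have wterm j : r`_j != 0 -> wlt w (mu j * (2 * D).+1).+1 (linsub T r`_j).
  move=> /degr/(wlt_linsub T)/allP wj; apply/allP => m /wj /=.
  rewrite wt_mdeg !ltnS => le.
  have le' : (mdeg m * (2 * D).+1 <= mu j * (2 * D).+1)%N.
    by rewrite leq_mul2r le orbT.
  exact: leq_trans (leq_trans (leq_addr _ _) (w_le m)) le'.
have wq j : wlt w (j * (2 * D).+2).+1 (quad C s ^+ j).
  by apply: wltE; exact: wlt_quad.
have lead : wlt w (J * (2 * D).+2 + mu J * w o1)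
    (linsub T p - c *: (quad C s ^+ J * 'x_o1 ^+ mu J)).
  rewrite Ep' (bigD1 J) //= addrAC; apply: wltD; last first.
    apply: wlt_sum => j jJ; have [->|rj] := eqVneq r`_j 0.
      by rewrite raddf0 mul0r wlt00.
    rewrite mulrC; apply: (wlt_mono _ (wltM (wq j) (wterm j rj))).
    have := ltK j rj jJ; rewrite /K w1; lia.
  rewrite mulrC scalerAr -mulrBr; apply: wltM => //.
  apply/wltP => m; rewrite mpolyXn mcoeffB mcoeffZ mcoeffX.
  have [<-|ne] := eqVneq _ m; first by rewrite mulr1 subrr eqxx.
  rewrite mulr0n mulr0 subr0 => mr.
  have dm : (mdeg m <= mu J)%N.
    have /(wlt_linsub T)/wltP/(_ m mr) := degr J rJ.
    by rewrite wt_mdeg ltnS.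
  have := w_le m; rewrite w1 => wm.
  have m1 : (m o1 <= mdeg m)%N by rewrite mdegE (bigD1 o1) //= leq_addr.
  have lt : (m o1 < mu J)%N.
    rewrite ltn_neqAle (leq_trans m1 dm) andbT; apply: contra_neq ne => e.
    apply/mnmP => i; rewrite mulmnE mnm1E.
    have [<-|i1] := eqVneq o1 i; first by rewrite mul1n e.
    have : (mdeg m <= m o1)%N by rewrite e.
    rewrite mdegE (bigD1 o1) //= (bigD1 i) 1?eq_sym //=; lia.
  nia.
have sharp := lead_sharp_division ws sK isT isT c0 lead.
have [||dv [h hh ph]] := sharp.
- by apply: coord_division ws sK _ _ _.
- elim: (mu J) => [|k IH]; first by rewrite expr0 -(mpolyC1 _ C) lapC.
  rewrite exprS lapXM // IH mulr0 add0r sK.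
  have E l : mderiv o1 ('x_(s o1) ^+ l : mpoly n.+2 C) = 0.
    elim: l => [|l IHl]; first by rewrite expr0 -(mpolyC1 _ C) mderivC.
    by rewrite exprS mderivM mderivXU IHl mul0r mulr0 addr0.
  by rewrite E mul0rn.
have itT' k q : iter k (lap id) (linsub T' q) = linsub T' (iter k (lap s) q).
  by elim: k => [//|k IH]; rewrite !iterS IH lapT'.
have T'K q : linsub T (linsub T' q) = q.
  rewrite linsub_comp; apply: linsub_id => i j.
  by move/matrixP: T'T => /(_ i j); rewrite !mxE.
exists (J + mu J)%N; split=> [f|].
  have [q fq] := dv (linsub T f); exists (linsub T' q).
  by rewrite -(p'K f) -(p'K p) -rmorphM -rmorphB itT' fq raddf0.
exists (linsub T' h); first by rewrite lapT' hh raddf0.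
rewrite -(p'K p) -rmorphM itT'; apply: contraNneq ph => e.
by rewrite -[iter _ _ _]T'K e raddf0.
Qed.

End Decomposition.

(** * The Stone-Weierstrass theorem *)

Section StoneWeierstrass.
Local Open Scope classical_set_scope.
Variables (R : realType) (T : topologicalType) (K : set T).
Hypothesis Kcompact : compact K.

(** If [Q K] failed, the sets whose complement in [K] satisfies [Q] would form a
    proper filter on [K] without cluster point. *)
Lemma compact_ind (Q : set T -> Prop) :
  Q set0 -> (forall A B, Q A -> Q B -> Q (A `|` B)) ->
  (forall A B, A `<=` B -> Q B -> Q A) ->
  (forall x, K x -> exists2 U, nbhs x U & Q (U `&` K)) -> Q K.
Proof.
move=> Q0 QU Qsub Qloc; apply: contrapT => QK.
pose F : set_system T := [set B | Q (K `\` B)].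
have FF : ProperFilter F.
  apply: Build_ProperFilter_ex.
    move=> B FB; apply: contrapT => nB; apply: QK; apply: Qsub FB => x Kx.
    by split=> // Bx; apply: nB; exists x.
  split.
  - by rewrite /F /= setDT.
  - move=> A B FA FB; rewrite /F /= setDIr; exact: QU.
  - by move=> A B AB; apply: Qsub => x [Kx nB]; split=> // /AB.
have [] := Kcompact FF; first by rewrite /F /= setDv.
move=> x [Kx clx]; have [U xU QUK] := Qloc x Kx.
have [|z [[Kz nUz] Uz]] := clx (K `\` U) U _ xU; last by [].
rewrite /F /=; apply: Qsub QUK => z [Kz nz]; split=> //.
by apply: contrapT => nU; apply: nz.
Qed.

Lemma within_continuousP (u : T -> R) : {within K, continuous u} ->
  forall x, K x -> forall e, 0 < e -> \forall z \near x, K z -> `|u z - u x| < e.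
Proof.
move=> /subspace_continuousP cu x Kx e e0.
have /cvgrPdist_lt/(_ e e0) := cu x Kx.
by rewrite near_withinE; apply: filterS => z h /h; rewrite distrC.
Qed.

Lemma within_continuous_bounded (u : T -> R) : {within K, continuous u} ->
  exists2 M, 0 < M & forall x, K x -> `|u x| <= M.
Proof.
move=> cu; apply: (compact_ind (Q := fun B => exists2 M, 0 < M &
  forall x, B x -> `|u x| <= M)).
- by exists 1.
- move=> A B [M M0 AM] [N N0 BN]; exists (M + N); first exact: addr_gt0.
  by move=> x [/AM|/BN] h; apply: (le_trans h); rewrite ?lerDl ?lerDr ltW.
- by move=> A B AB [M M0 BM]; exists M => // x /AB; exact: BM.
- move=> x Kx; have xU := within_continuousP cu Kx ltr01.
  exists [set z | K z -> `|u z - u x| < 1] => //.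
  exists (`|u x| + 1) => [|z [h Kz]]; first by rewrite ltr_wpDl.
  rewrite -[u z](subrK (u x)); apply: (le_trans (ler_normD _ _)).
  by rewrite addrC lerD2l ltW // h.
Qed.

Variable A : set (T -> R).
Hypothesis A_cst : forall c, A (fun=> c).
Hypothesis A_add : forall u v, A u -> A v -> A (fun x => u x + v x).
Hypothesis A_mul : forall u v, A u -> A v -> A (fun x => u x * v x).
Hypothesis A_cont : forall u, A u -> {within K, continuous u}.
Hypothesis A_sep :
  forall x y, K x -> K y -> x <> y -> exists2 u, A u & u x <> u y.

Definition approximable (u : T -> R) := forall e, 0 < e ->
  exists2 a, A a & forall x, K x -> `|u x - a x| < e.

Lemma approximable_in u : A u -> approximable u.
Proof. by move=> Au e e0; exists u => // x _; rewrite subrr normr0. Qed.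

Lemma approximableD u v : approximable u -> approximable v ->
  approximable (fun x => u x + v x).
Proof.
move=> hu hv e e0; have e2 : 0 < e / 2 by rewrite divr_gt0.
have [a Aa ua] := hu _ e2; have [b Ab vb] := hv _ e2.
exists (fun x => a x + b x); first exact: A_add.
move=> x Kx; rewrite opprD addrACA; apply: (le_lt_trans (ler_normD _ _)).
by rewrite (splitr e) ltrD ?ua ?vb.
Qed.

Lemma approximableZ c u : approximable u -> approximable (fun x => c * u x).
Proof.
move=> hu e e0; have d0 : 0 < `|c| + 1 by rewrite ltr_wpDl.
have [a Aa ua] := hu _ (divr_gt0 e0 d0).
exists (fun x => c * a x); first by apply: A_mul => //; exact: A_cst.
move=> x Kx; rewrite -mulrBr normrM.
have := ua x Kx; rewrite ltr_pdivlMr //; apply: le_lt_trans.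
by rewrite mulrC ler_wpM2l // lerDl.
Qed.

Lemma Bernoulli_le (x : R) k : -1 <= x -> 1 + k%:R * x <= (1 + x) ^+ k.
Proof.
move=> x1; elim: k => [|k IH]; first by rewrite mul0r addr0 expr0.
have x0 : 0 <= 1 + x by rewrite addrC -lerBlDr sub0r.
rewrite exprS; apply: le_trans (ler_wpM2l x0 IH).
rewrite -natr1; have : 0 <= k%:R * x ^+ 2 by rewrite mulr_ge0 ?sqr_ge0.
by lra.
Qed.

(** A sequence of polynomials in [s] converging to [|s|] uniformly on [-1, 1]:
    the error [|s| - p] gets multiplied by [1 - (|s| + p) / 2] at each step. *)
Fixpoint abs_iter (s : R) k : R :=
  if k is k'.+1 then abs_iter s k' + (s * s - abs_iter s k' * abs_iter s k') / 2
  else 0.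

Lemma abs_iter_bound (s : R) k : `|s| <= 1 ->
  0 <= abs_iter s k <= `|s| /\
  `|s| - abs_iter s k <= `|s| * (1 - `|s| / 2) ^+ k.
Proof.
move=> s1; have s0 := normr_ge0 s.
have ss : s * s = `|s| * `|s| by rewrite -normrM ger0_norm // -expr2 sqr_ge0.
elim: k => [|k [/andP[p0 ps] IH]] /=.
  by rewrite lexx s0 expr0 mulr1 subr0.
set p := abs_iter s k in p0 ps IH *; rewrite ss.
set a := `|s| in s1 s0 ss ps IH *.
have E : a - (p + (a * a - p * p) / 2) = (a - p) * (1 - (a + p) / 2) by field.
have ap : 0 <= a - p by rewrite subr_ge0.
have h1 : 0 <= 1 - (a + p) / 2 by lra.
split; last first.
  rewrite E exprSr mulrA; apply: ler_pM => //; lra.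
apply/andP; split; last by rewrite -subr_ge0 E mulr_ge0.
have : 0 <= (a - p) * (a + p) by rewrite mulr_ge0 // addr_ge0.
by lra.
Qed.

(** By Bernoulli's inequality [(1 + a / 2) ^ k] is at least [1 + k * a / 2], so
    that [a * (1 - a / 2) ^ k] is at most [2 / k]. *)
Lemma abs_iter_error (s : R) k : `|s| <= 1 ->
  `| `|s| - abs_iter s k.+1| <= 2 / k.+1%:R.
Proof.
move=> s1; have [/andP[p0 ps] h] := abs_iter_bound k.+1 s1.
rewrite [leLHS]ger0_norm ?subr_ge0 //; apply: (le_trans h).
have s0 := normr_ge0 s; set a := `|s| in s0 s1 *.
have b0 : 0 <= 1 - a / 2 by lra.
have B : 1 + k.+1%:R * (a / 2) <= (1 + a / 2) ^+ k.+1.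
  by apply: Bernoulli_le; lra.
have P : (1 - a / 2) ^+ k.+1 * (1 + a / 2) ^+ k.+1 <= 1.
  rewrite -exprMn exprn_ile1 //; last by nra.
  by rewrite mulr_ge0 //; lra.
have X0 : 0 <= (1 - a / 2) ^+ k.+1 by exact: exprn_ge0.
have k0 : 0 < k.+1%:R :> R by rewrite ltr0n.
rewrite ler_pdivlMr //; have := ler_wpM2l X0 B; move: P B X0 k0.
set X := (1 - _) ^+ _; set Y := (1 + _) ^+ _; set N := _%:R.
move=> P B X0 k0 XB; lra.
Qed.

Lemma approximable_norm u : approximable u -> approximable (fun x => `|u x|).
Proof.
move=> hu e e0; have e2 : 0 < e / 2 by rewrite divr_gt0.
have [a Aa ua] := hu _ e2.
have [M M0 aM] := within_continuous_bounded (A_cont Aa).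
pose s x := M^-1 * a x.
have As : A s by apply: A_mul => //; exact: A_cst.
have s1 x : K x -> `|s x| <= 1.
  by move=> Kx; rewrite normrM normfV (gtr0_norm M0) mulrC ler_pdivrMr // mul1r aM.
have Ai k : A (fun x => abs_iter (s x) k).
  elim: k => [|k IH] /=; first exact: A_cst.
  apply: A_add => //; apply: A_mul; last exact: A_cst.
  apply: A_add; first exact: A_mul.
  have -> : (fun x => - (abs_iter (s x) k * abs_iter (s x) k)) =
      (fun x => -1 * (abs_iter (s x) k * abs_iter (s x) k)).
    by apply/funext => x; rewrite mulN1r.
  by apply: A_mul; [exact: A_cst|exact: A_mul].
pose k := Num.truncn (4 * M / e).
have kP : 4 * M / e < k.+1%:R by exact: truncnS_gt.
exists (fun x => M * abs_iter (s x) k.+1); first by apply: A_mul => //; exact: A_cst.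
move=> x Kx; have aE : `|a x| = M * `|s x|.
  by rewrite normrM normfV (gtr0_norm M0) mulrA mulfV ?mul1r // gt_eqF.
rewrite -[`|u x|](subrK `|a x|) -addrA (splitr e).
apply: (le_lt_trans (ler_normD _ _)); apply: ltr_leD.
  by apply: le_lt_trans (ua x Kx); exact: ler_dist_dist.
rewrite aE -mulrBr normrM (gtr0_norm M0).
apply: (le_trans (ler_wpM2l (ltW M0) (abs_iter_error k (s1 x Kx)))).
have k0 : 0 < k.+1%:R :> R by rewrite ltr0n.
rewrite mulrA ler_pdivrMr //; move: kP; rewrite ltr_pdivrMr //; lra.
Qed.

Lemma approximable_max u v : approximable u -> approximable v ->
  approximable (fun x => Num.max (u x) (v x)).
Proof.
move=> hu hv.
have -> : (fun x => Num.max (u x) (v x)) =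
   (fun x => 2^-1 * ((u x + v x) + `|u x + -1 * v x|)).
  by apply/funext => x; rewrite maxr_absE mulN1r mulrC.
apply: approximableZ; apply: approximableD; first exact: approximableD.
by apply: approximable_norm; apply: approximableD => //; exact: approximableZ.
Qed.

Lemma approximable_min u v : approximable u -> approximable v ->
  approximable (fun x => Num.min (u x) (v x)).
Proof.
move=> hu hv.
have -> : (fun x => Num.min (u x) (v x)) =
   (fun x => -1 * Num.max (-1 * u x) (-1 * v x)).
  by apply/funext => x; rewrite !mulN1r oppr_max !opprK.
by apply: approximableZ; apply: approximable_max; exact: approximableZ.
Qed.

Lemma interpolation x y c d : K x -> K y -> (x = y -> c = d) ->
  exists2 u, A u & u x = c /\ u y = d.
Proof.
move=> Kx Ky xy; have [e|ne] := pselect (x = y).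
  by exists (fun=> c) => //; rewrite -xy.
have [a Aa /eqP axy] := A_sep Kx Ky ne.
have s0 : a y - a x != 0 by rewrite subr_eq0 eq_sym.
pose l := (d - c) / (a y - a x).
exists (fun z => l * a z + (c - l * a x)).
  by apply: A_add; [apply: A_mul => //|]; exact: A_cst.
by split; rewrite /l; field.
Qed.

Section Approximation.
Variable f : T -> R.
Hypothesis fcont : {within K, continuous f}.

(** Interpolate [f] at [x] and [y]; the interpolant exceeds [f - e] near [y], and a
    maximum of finitely many of them does so on [K]. *)
Lemma approx_above x e : K x -> 0 < e ->
  exists2 g, approximable g & g x = f x /\ forall z, K z -> f z - e < g z.
Proof.
move=> Kx e0; apply: (compact_ind (Q := fun B => exists2 g, approximable g &
  g x = f x /\ forall z, B z -> f z - e < g z)).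
- by exists (fun=> f x); [exact/approximable_in/A_cst|split].
- move=> B B' [g hg [gx gB]] [h hh [hx hB]].
  exists (fun z => Num.max (g z) (h z)); first exact: approximable_max.
  split; first by rewrite gx hx maxxx.
  by move=> z [/gB|/hB] l; rewrite lt_max l ?orbT.
- by move=> B B' BB [g hg [gx gB]]; exists g => //; split=> // z /BB; exact: gB.
- move=> y Ky; have [|g Ag [gx gy]] := @interpolation x y (f x) (f y) Kx Ky.
    by move=> ->.
  have e2 : 0 < e / 2 by rewrite divr_gt0.
  refine (ex_intro2 _ _ _ (filterI (within_continuousP fcont Ky e2)
    (within_continuousP (A_cont Ag) Ky e2)) _).
  exists g; first exact: approximable_in.
  split=> // z [[h1 h2] Kz]; have := h1 Kz; have := h2 Kz.
  rewrite gy !ltr_distl => /andP[l1 _] /andP[_ l2]; lra.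
Qed.

(** Dually, take a minimum of finitely many of the functions of [approx_above];
    each is first replaced by an element of [A], which is continuous. *)
Theorem stone_weierstrass e : 0 < e ->
  exists2 a, A a & forall x, K x -> `|f x - a x| < e.
Proof.
move=> e0; have e4 : 0 < e / 4 by rewrite divr_gt0.
have [[x0 Kx0]|K0] := pselect (exists x, K x); last first.
  by exists (fun=> 0) => // x Kx; case: K0; exists x.
have loc x : K x -> exists2 a, A a & a x < f x + e / 4 /\
    forall z, K z -> f z - e / 2 < a z.
  move=> Kx; have [g hg [gx gK]] := approx_above Kx e4.
  have [a Aa ga] := hg _ e4; exists a => //; split.
    by have := ga x Kx; rewrite gx ltr_distl => /andP[l1 l2]; lra.
  by move=> z Kz; have := ga z Kz; have := gK z Kz;
    rewrite ltr_distl => l /andP[l1 l2]; lra.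
have [g hg [gl gu]] : exists2 g, approximable g &
    (forall z, K z -> f z - e / 2 < g z) /\
    (forall z, K z -> g z < f z + e * (3 / 4)).
  apply: (compact_ind (Q := fun B => exists2 g, approximable g &
    (forall z, K z -> f z - e / 2 < g z) /\
    (forall z, B z -> g z < f z + e * (3 / 4)))).
  - by have [a Aa [_ al]] := loc x0 Kx0; exists a; [exact: approximable_in|split].
  - move=> B B' [g hg [gl gB]] [h hh [hl hB]].
    exists (fun z => Num.min (g z) (h z)); first exact: approximable_min.
    split; first by move=> z Kz; rewrite lt_min gl ?hl.
    by move=> z [/gB|/hB] l; rewrite gt_min l ?orbT.
  - by move=> B B' BB [g hg [gl gB]]; exists g => //; split=> // z /BB; exact: gB.
  - move=> x Kx; have [a Aa [ax al]] := loc x Kx.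
    refine (ex_intro2 _ _ _ (filterI (within_continuousP fcont Kx e4)
      (within_continuousP (A_cont Aa) Kx e4)) _).
    exists a; first exact: approximable_in.
    split=> // z [[h1 h2] Kz]; have := h1 Kz; have := h2 Kz.
    rewrite !ltr_distl => /andP[_ l1] /andP[l2 _]; lra.
have [a Aa ga] := hg _ e4; exists a => // x Kx.
have := ga x Kx; have := gl x Kx; have := gu x Kx.
rewrite !ltr_distl => l1 l2 /andP[l3 l4]; lra.
Qed.

End Approximation.
End StoneWeierstrass.

(** * Density of polynomials on a compact zero set *)

Section PolynomialDensity.
Local Open Scope classical_set_scope.
Variables (R : realType) (n : nat).
Local Notation poly_n := (mpoly n R[i]).
Implicit Types p q : poly_n.

Lemma pevalD p q x : peval (p + q) x = peval p x + peval q x.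
Proof. exact: mevalD. Qed.

Lemma pevalM p q x : peval (p * q) x = (peval p x : R[i]) * peval q x.
Proof. exact: mevalM. Qed.

Lemma pevalC (c : R[i]) (x : 'rV[R]_n) : peval (mpolyC n c) x = c.
Proof. exact: mevalC. Qed.

Lemma pevalX i (x : 'rV[R]_n) : peval ('x_i : poly_n) x = (x ord0 i)%:C%C.
Proof. exact: mevalXU. Qed.

Lemma coord_cont i : continuous (fun x : 'rV[R]_n => x ord0 i).
Proof. exact: coord_continuous. Qed.

Lemma contD (u v : 'rV[R]_n -> R) : continuous u -> continuous v ->
  continuous (fun x => u x + v x).
Proof. by move=> cu cv x; apply: continuousD; [exact: cu|exact: cv]. Qed.

Lemma contM (u v : 'rV[R]_n -> R) : continuous u -> continuous v ->
  continuous (fun x => u x * v x).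
Proof. by move=> cu cv x; apply: continuousM; [exact: cu|exact: cv]. Qed.

Lemma contN (u : 'rV[R]_n -> R) : continuous u -> continuous (fun x => - u x).
Proof. by move=> cu x; apply: continuousN; exact: cu. Qed.

(** Reduces the topology of zero sets in [C] to continuous real-valued functions. *)
Lemma peval_re_im p : exists u v : 'rV[R]_n -> R,
  [/\ continuous u, continuous v & forall x, peval p x = (u x +i* v x)%C].
Proof.
elim/mpoly_ring_ind: p => [c|i|p q|p q].
- exists (fun=> complex.Re c), (fun=> complex.Im c).
  split=> [||x]; [exact: cst_continuous|exact: cst_continuous|].
  by rewrite pevalC; case: c.
- exists (fun x => x ord0 i), (fun=> 0).
  by split=> [||x]; [exact: coord_cont|exact: cst_continuous|rewrite pevalX].
- move=> [u [v [cu cv E]]] [u' [v' [cu' cv' E']]].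
  exists (fun x => u x + u' x), (fun x => v x + v' x).
  by split=> [||x]; [exact: contD|exact: contD|rewrite pevalD E E'].
- move=> [u [v [cu cv E]]] [u' [v' [cu' cv' E']]].
  exists (fun x => u x * u' x + - (v x * v' x)), (fun x => u x * v' x + v x * u' x).
  split=> [||x]; last by rewrite pevalM E E'; simpc.
  - by apply: contD; [|apply: contN]; exact: contM.
  - by apply: contD; exact: contM.
Qed.

Lemma zero_locus_ball_compact p r : compact (zero_locus_ball p r).
Proof.
have [u [v [cu cv E]]] := peval_re_im p.
have sq x : 0 <= \sum_(i < n) (x : 'rV[R]_n) ord0 i ^+ 2.
  by apply: sumr_ge0 => i _; exact: sqr_ge0.
have [r0|r0] := ltP r 0.
  rewrite (_ : zero_locus_ball p r = set0); first exact: compact0.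
  apply/seteqP; split=> // x [_]; rewrite /enorm leNgt => /negP[].
  exact: lt_le_trans r0 (sqrtr_ge0 _).
have locE : zero_locus_ball p r = (u @^-1` [set 0] `&` v @^-1` [set 0]) `&`
    (fun x : 'rV[R]_n => \sum_(i < n) x ord0 i * x ord0 i) @^-1` [set y | y <= r ^+ 2].
  have nE (x : 'rV[R]_n) : (enorm x <= r) = (\sum_(i < n) x ord0 i * x ord0 i <= r ^+ 2).
    by rewrite /enorm -[in LHS](ger0_norm r0) -sqrtr_sqr ler_sqrt ?sqr_ge0.
  apply/seteqP; split=> x /=; rewrite /zero_locus_ball /= E nE.
    by move=> [[-> ->]].
  by move=> [[-> ->]].
apply: bounded_closed_compact.
  exists r; split; first exact: num_real.
  move=> M rM x [_ xr].
  have M0 : 0 <= M by apply: ltW; exact: le_lt_trans rM.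
  rewrite /= [leLHS]/Num.norm /= mx_normrE; apply/bigmax_leP; split=> // -[i j] _ /=.
  rewrite ord1; apply: le_trans (ltW rM); apply: le_trans xr.
  rewrite -sqrtr_sqr /enorm ler_sqrt //.
  rewrite (bigD1 j) //= lerDl; apply: sumr_ge0 => k _; exact: sqr_ge0.
rewrite locE; apply: closedI; first apply: closedI.
- by apply: preimage_closed; [move=> x _; exact: cu|exact: closed_eq].
- by apply: preimage_closed; [move=> x _; exact: cv|exact: closed_eq].
- apply: preimage_closed; last exact: closed_le.
  suff cs : continuous (fun x : 'rV[R]_n => \sum_(i < n) x ord0 i * x ord0 i).
    by move=> x _; exact: cs.
  elim: (index_enum _) => [|i l IH].
    by under eq_fun do rewrite big_nil; exact: cst_continuous.
  under eq_fun do rewrite big_cons.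
  by apply: contD IH; apply: contM; exact: coord_cont.
Qed.

Lemma normc_re_im (z : R[i]) : Normc.normc z <= `|complex.Re z| + `|complex.Im z|.
Proof.
case: z => a b /=; rewrite -[leRHS]ger0_norm ?addr_ge0 //.
rewrite -sqrtr_sqr ler_sqrt ?sqr_ge0 // sqrrD !real_normK ?num_real //.
by rewrite lerD2r lerDl mulrn_wge0 // mulr_ge0.
Qed.

Lemma re_im_le_norm (z : R[i]) (e : R) : `|z| < e%:C%C ->
  `|complex.Re z| < e /\ `|complex.Im z| < e.
Proof.
rewrite normc_def ltcR => h; split; apply: le_lt_trans h.
  by rewrite -sqrtr_sqr ler_sqrt ?addr_ge0 ?sqr_ge0 // lerDl sqr_ge0.
by rewrite -sqrtr_sqr ler_sqrt ?addr_ge0 ?sqr_ge0 // lerDr sqr_ge0.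
Qed.

Lemma within_continuous_re_im (K : set 'rV[R]_n) (f : 'rV[R]_n -> R[i]^o) :
  {within K, continuous f} ->
  {within K, continuous (fun x => complex.Re (f x))} /\
  {within K, continuous (fun x => complex.Im (f x))}.
Proof.
move=> /subspace_continuousP cf.
by split; apply/subspace_continuousP => x Kx; apply/cvgrPdist_lt => e e0;
  have /cvgrPdist_lt/(_ e%:C%C) := cf x Kx; rewrite ltcR => /(_ e0);
  apply: filterS => z /re_im_le_norm[]; rewrite !raddfB.
Qed.

Lemma polynomials_dense (K : set 'rV[R]_n) (f : 'rV[R]_n -> R[i]^o) (e : R) :
  compact K -> {within K, continuous f} -> 0 < e ->
  exists q : poly_n, forall x, K x -> Normc.normc (f x - peval q x) < e.
Proof.
move=> cK /within_continuous_re_im[cRe cIm] e0.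
pose A : set ('rV[R]_n -> R) :=
  [set u : 'rV[R]_n -> R | continuous u /\ exists p, forall x, peval p x = (u x)%:C%C].
have A_cst c : A (fun=> c).
  by split; [exact: cst_continuous|exists (mpolyC n c%:C%C) => x; rewrite pevalC].
have A_add u v : A u -> A v -> A (fun x => u x + v x).
  move=> [cu [p pu]] [cv [q qv]]; split; first exact: contD.
  by exists (p + q) => x; rewrite pevalD pu qv -rmorphD.
have A_mul u v : A u -> A v -> A (fun x => u x * v x).
  move=> [cu [p pu]] [cv [q qv]]; split; first exact: contM.
  by exists (p * q) => x; rewrite pevalM pu qv -rmorphM.
have A_cont u : A u -> {within K, continuous u}.
  by move=> [cu _]; exact: continuous_subspaceT.
have A_sep x y : K x -> K y -> x <> y -> exists2 u, A u & u x <> u y.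
  move=> _ _ xy; have [i xi] : exists i, x ord0 i <> y ord0 i.
    apply: contrapT => h; apply: xy; apply/rowP => i.
    by apply: contrapT => xi; apply: h; exists i.
  exists (fun z => z ord0 i) => //; split; first exact: coord_cont.
  by exists 'x_i => z; rewrite pevalX.
have e2 : 0 < e / 2 by rewrite divr_gt0.
have SW := stone_weierstrass cK A_cst A_add A_mul A_cont A_sep.
have [u [_ [p pu]] fu] := SW _ cRe _ e2.
have [v [_ [q qv]] fv] := SW _ cIm _ e2.
exists (p + mpolyC n 'i%C * q) => x Kx.
rewrite pevalD pevalM pevalC pu qv (splitr e).
have -> : f x - ((u x)%:C%C + 'i%C * (v x)%:C%C) =
    ((complex.Re (f x) - u x) +i* (complex.Im (f x) - v x))%C :> R[i].
  by rewrite [f x in LHS]complexE; simpc.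
apply: le_lt_trans (normc_re_im _) _; apply: ltrD; [exact: fu|exact: fv].
Qed.

End PolynomialDensity.

(** * The density theorem *)

Lemma leq_max_polyharm_degree (C : comNzRingType) n (p h : mpoly n C) N :
  Defs.harmonic h -> iter_laplacian N (p * h) != 0 ->
  (N <= max_polyharm_degree p)%N.
Proof.
move=> hh ph; have [ub _] := max_polyharm_degreeP p.
have /= := ub (polyharm_degree (p * h)) (ex_intro2 _ _ h hh erefl).
apply: contraTT; rewrite -!ltnNge => lt.
have: iter_laplacian (polyharm_degree (p * h)).+1 (p * h) == 0.
  by rewrite /polyharm_degree; case: ex_minnP.
move=> /eqP d0; rewrite ltnNge; apply/negP => le.
case/negP: ph; apply/eqP; rewrite -(subnK (leq_ltn_trans le lt)).
rewrite /iter_laplacian iterD -/(iter_laplacian _ (p * h)) d0.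
exact: iter_laplacian0.
Qed.

Lemma polyharmonic_division (C : numClosedFieldType) n (p f : mpoly n.+1 C) :
  p != 0 ->
  exists q, iter_laplacian (max_polyharm_degree p) (f - p * q) = 0.
Proof.
move=> p0; have [N [div [h hh ph]]] : exists N, sharp_division id p N.
  by case: n p p0 {f} => [|n] p p0; [exact: sharp_division1|exact: sharp_division2].
have [q fq] := div f; exists q.
have NP := leq_max_polyharm_degree hh ph.
rewrite -(subnK NP) /iter_laplacian iterD [X in iter _ _ X]fq.
exact: iter_laplacian0.
Qed.

Unset Implicit Arguments.

Theorem corollary17 (R : realType) (n : nat) (P : mpoly n R[i]) (r : R) :
  P != 0 -> 0 < r ->
  dense_in_CK (zero_locus_ball P r) (polyharmonic (max_polyharm_degree P)).
Proof.
move=> P0 _ f cf e e0.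
suff [q qP qf] : exists2 q, polyharmonic (max_polyharm_degree P) q &
    forall x, zero_locus_ball P r x -> Normc.normc (f x - peval q x) < e / 2.
  exists q => //; apply: (@le_lt_trans _ _ (e / 2)%:E).
    by apply: ge_ereal_sup => _ [x Kx <-]; rewrite lee_fin ltW // qf.
  by rewrite lte_fin ltr_pdivrMr // ltr_pMr // ltr1n.
case: n P P0 f cf => [|n] P P0 f cf.
  exists 0; first exact: iter_laplacian0.
  move=> x [Px _]; case/eqP: P0; rewrite (nvar0_mpolyC P) in Px *.
  by move: Px; rewrite pevalC => ->; rewrite mpolyC0.
have e2 : 0 < e / 2 by rewrite divr_gt0.
have [g gf] := polynomials_dense (@zero_locus_ball_compact _ _ P r) cf e2.
have [q gq] := polyharmonic_division g P0.
exists (g - P * q) => // x Kx; have := gf x Kx; case: Kx => Px _.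
suff -> : peval (g - P * q) x = peval g x by [].
by rewrite /peval mevalB mevalM [X in X * _]Px mul0r subr0.
Qed.
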